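(* Let $\beta>0$, $0<\eta\le1/\beta$, and let $T\ge2$ be an integer. Let $M,s>0$ be such that $\min_{i\in[m]}\mu_i\ge s$, $\min_{j\in[n]}\nu_j\ge s$ and $\max_{i,j}|c_{ij}|\le M$. Let $p_\star$ be the optimal value of the optimal transport linear program $$\min\{\langle c,\pi\rangle:\ \pi\in\mathbb{R}^{m\times n},\ \pi\mathbf{1}_n=\mu,\ \pi^\top\mathbf{1}_m=\nu,\ \pi\ge0\}.$$ Run the OT dual ascent algorithm with step size $\eta$ for $T$ steps, obtaining $\boldsymbol\lambda_t=(\phi_t,\psi_t)$; let $\tilde t\in\mathrm{argmin}_{t=1,\dots,T}\|\nabla f_\beta(\boldsymbol\lambda_t)\|_*$, let $\tilde\pi=\pi_{\beta,\boldsymbol\lambda_{\tilde t}}$, and let $\hat\pi$ be the output of the rounding procedure applied to $\tilde\pi$ with target marginals $\mu,\nu$ (algorithm, norm and rounding procedure are defined in the context). Then $$\langle c,\hat\pi\rangle\le p_\star+\frac{128M\left[2M+\frac{\log(1/s)+1}{\beta}\right]}{(T-1)\eta}+\beta^{-1}\log(mn).$$ In particular, to achieve $\langle c,\hat\pi\rangle\le p_\star+\varepsilon$ for a given target $\varepsilon>0$, one can take $\beta=2\varepsilon^{-1}\log(mn)$, $\eta=1/\beta$, and $$T=O\big((M/\varepsilon)^2\log(mn)+(M/\varepsilon)[1+\log(1/s)]\big).$$ In the regime $\varepsilon=O\Big(\frac{M\log(mn)}{\log(1/s)+1}\Big)$ this simplifies to $T=O\big((M/\varepsilon)^2\log(mn)\big)$,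 and the total computational complexity is $O\big((M/\varepsilon)^2\,mn\log(mn)\big)$.
   Context: Let $\mu\in\Delta_m$, $\nu\in\Delta_n$ be probability vectors and $c\in\mathbb{R}^{m\times n}$ a cost matrix. $[n]=\{1,\dots,n\}$; $\mathbf{1}_n$ is the all-ones vector in $\mathbb{R}^n$; $\langle\cdot,\cdot\rangle$ is the Frobenius inner product. For $\beta>0$ define on $\mathbb{R}^m\times\mathbb{R}^n$ the (negated) dual objective of entropically regularized optimal transport $$f_\beta(\phi,\psi)=-\mu^\top\phi-\nu^\top\psi+\beta^{-1}\log\sum_{i,j}e^{-\beta(c_{ij}-\phi_i-\psi_j)},$$ and let $\pi_{\beta,(\phi,\psi)}\in\mathbb{R}^{m\times n}$ be the matrix with entries proportional to $e^{-\beta(c_{ij}-\phi_i-\psi_j)}$, normalized so that the entries sum to $1$. The norm on gradients is $\|(a,b)\|_*=\sqrt{\tfrac12(\|a\|_1^2+\|b\|_1^2)}$ for $(a,b)\in\mathbb{R}^m\times\mathbb{R}^n$. OT dual ascent algorithm with step size $\eta$: start with $\phi_0=0$, $\psi_0=0$. For $t=0,1,2,\dots$ set $\pi_t=\pi_{\beta,(\phi_t,\psi_t)}$, $\mu_t=\pi_t\mathbf{1}_n$, $\nu_t=\pi_t^\top\mathbf{1}_m$, and $$\tilde\phi_t=\phi_t-\tfrac{\eta}{2}\|\mu_t-\mu\|_1\,\mathrm{sign}(\mu_t-\mu),\qquad \tilde\psi_t=\psi_t-\tfrac{\eta}{2}\|\nu_t-\nu\|_1\,\mathrm{sign}(\nu_t-\nu),$$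 $$\phi_{t+1}=\tilde\phi_t-\big(\tfrac1m\mathbf{1}_m^\top\tilde\phi_t\big)\mathbf{1}_m,\qquad \psi_{t+1}=\tilde\psi_t-\big(\tfrac1n\mathbf{1}_n^\top\tilde\psi_t\big)\mathbf{1}_n,$$ where $\mathrm{sign}$ acts entrywise (with $\mathrm{sign}(0)=0$). Rounding procedure (Algorithm 2 of Altschuler, Weed and Rigollet, 2017): given a matrix $F\ge0$ with positive row and column sums and target marginals $\mu,\nu$, let $x_i=\min\{1,\mu_i/(F\mathbf{1}_n)_i\}$ and $F'=\mathrm{diag}(x)F$; let $y_j=\min\{1,\nu_j/(F'^\top\mathbf{1}_m)_j\}$ and $F''=F'\mathrm{diag}(y)$; let $e=\mu-F''\mathbf{1}_n$ and $e'=\nu-F''^\top\mathbf{1}_m$; output $F''+ee'^\top/\|e\|_1$ (output $F''$ if $e=0$). It takes $O(mn)$ operations. Convention: $O(\cdot)$ hides absolute constants; $T$ is always an integer at least $2$ (so $T=O(X)$ is understood up to this requirement), and for the choice $\beta=2\varepsilon^{-1}\log(mn)$ one has $mn\ge2$. Computational complexity counts arithmetic operations (including scalar exponentials). *)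

(* Defs.v *)
(* MathComp / MathComp-Analysis *)
From HB Require Import structures.
From mathcomp Require Import all_boot all_order all_algebra.
From mathcomp Require Import all_classical all_reals all_analysis.

Set Implicit Arguments.
Unset Strict Implicit.
Unset Printing Implicit Defensive.

Import Order.TTheory GRing.Theory Num.Theory.
Import numFieldNormedType.Exports.

Local Open Scope classical_set_scope.
Local Open Scope ring_scope.

(** ** Optimal transport and its entropic dual *)
Section OptimalTransport.
Variable R : realType.

Definition prob_vec n (p : 'cV[R]_n) : Prop :=
  (forall i, 0 <= p i 0) /\ \sum_i p i 0 = 1.

Definition ones n : 'cV[R]_n := const_mx 1.

Definition norm1 n (v : 'cV[R]_n) : R := \sum_i `|v i 0|.

Definition frob m n (A B : 'M[R]_(m, n)) : R := \sum_i \sum_j A i j * B i j.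

Definition coupling m n (mu : 'cV[R]_m) (nu : 'cV[R]_n) : set 'M[R]_(m, n) :=
  [set pi | [/\ pi *m ones n = mu, pi^T *m ones m = nu
             & forall i j, 0 <= pi i j]].

Definition ot_value m n (mu : 'cV[R]_m) (nu : 'cV[R]_n) (c : 'M[R]_(m, n)) : R :=
  inf [set frob c pi | pi in coupling mu nu].

Section Dual.
Variables (m n : nat) (beta : R) (c : 'M[R]_(m, n)).
Variables (mu : 'cV[R]_m) (nu : 'cV[R]_n).

Definition gibbs_weight (l : 'cV[R]_m * 'cV[R]_n) (i : 'I_m) (j : 'I_n) : R :=
  expR (- beta * (c i j - l.1 i 0 - l.2 j 0)).

Definition dual_obj (l : 'cV[R]_m * 'cV[R]_n) : R :=
  - \sum_i mu i 0 * l.1 i 0 - \sum_j nu j 0 * l.2 j 0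
  + beta^-1 * ln (\sum_i \sum_j gibbs_weight l i j).

Definition gibbs (l : 'cV[R]_m * 'cV[R]_n) : 'M[R]_(m, n) :=
  \matrix_(i, j) (gibbs_weight l i j / \sum_i' \sum_j' gibbs_weight l i' j').

End Dual.

Definition gradient m n (f : 'cV[R]_m * 'cV[R]_n -> R)
    (l : 'cV[R]_m * 'cV[R]_n) : 'cV[R]_m * 'cV[R]_n :=
  (\col_i 'D_(delta_mx i 0, 0) f l, \col_j 'D_(0, delta_mx j 0) f l).

Definition dual_norm m n (g : 'cV[R]_m * 'cV[R]_n) : R :=
  Num.sqrt (2^-1 * (norm1 g.1 ^+ 2 + norm1 g.2 ^+ 2)).

End OptimalTransport.

(** ** Dual ascent and rounding *)
Section Algorithm.
Variable R : realType.

Definition mean_shift n (v : 'cV[R]_n) : 'cV[R]_n :=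
  v - (n%:R^-1 * \sum_i v i 0) *: ones R n.

(* [Num.sg 0 = 0] *)
Definition sign_step n (eta : R) (g : 'cV[R]_n) : 'cV[R]_n :=
  (eta / 2 * norm1 g) *: map_mx Num.sg g.

Section Iterates.
Variables (m n : nat) (beta eta : R) (c : 'M[R]_(m, n)).
Variables (mu : 'cV[R]_m) (nu : 'cV[R]_n).

Definition ascent_step (l : 'cV[R]_m * 'cV[R]_n) : 'cV[R]_m * 'cV[R]_n :=
  let pi := gibbs beta c l in
  (mean_shift (l.1 - sign_step eta (pi *m ones R n - mu)),
   mean_shift (l.2 - sign_step eta (pi^T *m ones R m - nu))).

Definition iterate (t : nat) : 'cV[R]_m * 'cV[R]_n :=
  iter t ascent_step (0, 0).

Definition iterate_grad_norm (t : nat) : R :=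
  dual_norm (gradient (dual_obj beta c mu nu) (iterate t)).

Definition best_iterate (T tt : nat) : Prop :=
  (1 <= tt <= T)%N /\
  forall t, (1 <= t <= T)%N -> iterate_grad_norm tt <= iterate_grad_norm t.

End Iterates.

Definition rounding m n (F : 'M[R]_(m, n)) (mu : 'cV[R]_m) (nu : 'cV[R]_n) :
    'M[R]_(m, n) :=
  let x := \row_i Num.min 1 (mu i 0 / (F *m ones R n) i 0) in
  let F' := diag_mx x *m F in
  let y := \row_j Num.min 1 (nu j 0 / (F'^T *m ones R m) j 0) in
  let F'' := F' *m diag_mx y in
  let e := mu - F'' *m ones R n in
  let e' := nu - F''^T *m ones R m in
  if e == 0 then F'' else F'' + (norm1 e)^-1 *: (e *m e'^T).

Definition ot_output m n (beta eta : R) (c : 'M[R]_(m, n))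
    (mu : 'cV[R]_m) (nu : 'cV[R]_n) (t : nat) : 'M[R]_(m, n) :=
  rounding (gibbs beta c (iterate beta eta c mu nu t)) mu nu.

Definition ot_instance m n (mu : 'cV[R]_m) (nu : 'cV[R]_n)
    (c : 'M[R]_(m, n)) (M s : R) : Prop :=
  [/\ prob_vec mu, prob_vec nu, 0 < M & 0 < s] /\
  [/\ forall i, s <= mu i 0, forall j, s <= nu j 0
    & forall i j, `|c i j| <= M].

End Algorithm.

(** ** Arithmetic complexity

    Straight-line programs over real-valued registers. Every instruction costs
    one, so the number of operations of a program is its length. The only
    literals are natural numbers, so no data can be hidden in a program. *)
Inductive instr : Type :=
| ILit of nat & nat
| IAdd of nat & nat & nat
| ISub of nat & nat & nat
| IMul of nat & nat & nat
| IDiv of nat & nat & nat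
| IExp of nat & nat
| ISel of nat & nat & nat & nat & nat.

Section Machine.
Variable R : realType.

Definition set_reg (r : nat -> R) (d : nat) (v : R) : nat -> R :=
  fun k => if k == d then v else r k.

(* The first argument of each instruction is the destination register. *)
Definition exec (r : nat -> R) (i : instr) : nat -> R :=
  match i with
  | ILit d k => set_reg r d k%:R
  | IAdd d a b => set_reg r d (r a + r b)
  | ISub d a b => set_reg r d (r a - r b)
  | IMul d a b => set_reg r d (r a * r b)
  | IDiv d a b => set_reg r d (r a / r b)
  | IExp d a => set_reg r d (expR (r a))
  | ISel d a b x y => set_reg r d (if r a <= r b then r x else r y)
  end.

Definition run (P : seq instr) (r : nat -> R) : nat -> R := foldl exec r P.

(* Parameters, then marginals, then the cost matrix in row-major order. *)
Definition input_regs m n (beta eta : R) (c : 'M[R]_(m, n))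
    (mu : 'cV[R]_m) (nu : 'cV[R]_n) : nat -> R :=
  nth 0 ([:: beta; eta] ++ [seq mu i 0 | i <- enum 'I_m]
         ++ [seq nu j 0 | j <- enum 'I_n]
         ++ [seq c i j | i <- enum 'I_m, j <- enum 'I_n]).

(* One program serves all inputs of the given dimensions and number of steps;
   it leaves the output matrix, in row-major order, in registers 0 to mn-1. *)
Definition computes_ot_output (m n T : nat) (P : seq instr) : Prop :=
  forall (beta eta : R) (c : 'M[R]_(m, n)) (mu : 'cV[R]_m) (nu : 'cV[R]_n),
    0 < beta -> 0 < eta -> prob_vec mu -> prob_vec nu ->
    exists2 tt, best_iterate beta eta c mu nu T tt &
      forall (i : 'I_m) (j : 'I_n),
        run P (input_regs beta eta c mu nu) (i * n + j)%N
        = ot_output beta eta c mu nu tt i j.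

End Machine.

(* Main.v *)
(** The objective [f] is convex and, by Hoeffding's lemma, smooth, so a signed
    step from [l] decreases it by at least [eta/2 |grad f(l)|^2]. The gap of a
    row whose dual variable lags by more than [2M + log(1/s)/beta] is negative,
    so the iterates keep a spread of order [W = 2M + (log(1/s) + 1)/beta]. A
    minimizer is not needed: one Sinkhorn update of the last iterate gives a
    point below all iterates with the same spread, so convexity yields
    [f(l_t) - f(l') <= 4W |grad f(l_t)|], and the best gradient norm is
    [O(W / (eta T))]. Rounding turns a marginal gap [G] into an error of at most
    [M G] in the cost; it is applied once to the Gibbs matrix and once, in the
    opposite direction, to a coupling competing with it. Programs are branch-free:
    the best Gibbs matrix so far is kept by comparing squared gradient norms. *)

Require Import Defs.
From HB Require Import structures.
From mathcomp Require Import all_boot all_order all_algebra.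
From mathcomp Require Import all_classical all_reals all_analysis.
From mathcomp Require Import ring lra zify.

Set Implicit Arguments.
Unset Strict Implicit.
Unset Printing Implicit Defensive.

Import Order.TTheory GRing.Theory Num.Theory.
Import numFieldNormedType.Exports.

Local Open Scope ring_scope.

Local Open Scope classical_set_scope.

(** * Hoeffding's lemma *)

Section ExponentialMoment.
Variable R : realType.

(** All that is used of [dual_obj] comes from one identity: its increment from [l] to [l'] is a
    logarithmic moment generating function of [l' - l] under the Gibbs matrix at [l], minus a linear
    term. [best_iterate] speaks of directional derivatives; the lower and upper bounds on the
    increment also identify these with the marginal gap, so the logarithm is never differentiated.

    Each block of the gap sums to zero, hence only the oscillation of a dual vector within a block
    matters. This is why the invariant of the ascent is a spread rather than a norm, and why
    recentring is harmless.

    Summing the descent inequality alone would bound the best gradient by a multiple of 1/sqrt T,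
    and T would grow like the cube of 1/eps, since eta is itself of order eps. Descent is therefore
    used twice: over the first half of the steps it brings the objective gap down to order 1/T, and
    over the second half only that gap is left to spend, which makes the best squared gradient of
    order 1/T^2. *)

Lemma ge0_derive_ge_at0 (f df : R -> R) :
  (forall x : R, is_derive x 1 f (df x)) -> (forall x, 0 <= x -> 0 <= df x) ->
  forall a, 0 <= a -> f 0 <= f a.
Proof.
move=> fdf df0 a a0.
have fc : {within `[0, a], continuous f}.
  by apply: derivable_within_continuous => x _; case: (fdf x).
have [c] := MVT_segment a0 (fun x _ => fdf x) fc.
rewrite in_itv/= subr0 => /andP[c0 _] E.
by rewrite -subr_ge0 E mulr_ge0// df0.
Qed.

Lemma is_derive_expR_quad (p x : R) :
  is_derive x 1 (fun y : R => expR (p * y + y ^+ 2 / 2))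
                ((p + x) * expR (p * x + x ^+ 2 / 2)).
Proof.
have -> : (fun y : R => expR (p * y + y ^+ 2 / 2))
  = expR \o (cst p * id + cst 2^-1 * (id * id)).
  by apply/funext => y /=; congr expR; rewrite !fctE /=; by field.
apply: is_derive_eq.
rewrite !fctE /= /GRing.scale/= mulrC; congr (_ * expR _); by field.

Qed.

Lemma is_derive_expR_lin (p x : R) :
  is_derive x 1 (fun y : R => expR (p * y)) (p * expR (p * x)).
Proof.
have -> : (fun y : R => expR (p * y)) = expR \o (cst p * id).
  by apply/funext.
apply: is_derive_eq.
by rewrite !fctE /= /GRing.scale/= mulrC; congr (_ * expR _); ring.
Qed.

(** With E the exponential factor, the derivative of (1 + p + x) E(x) is (p + x)^2 E(x), because 1 +
    (1 + p + x)(p - 1 + x) is a square; so the right-hand side is least at a = 0. *)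
Lemma hoeffding_aux (p a : R) : 0 <= a ->
  1 + p <= (1 + p + a) * expR ((p - 1) * a + a ^+ 2 / 2).
Proof.
pose E (y : R) := expR ((p - 1) * y + y ^+ 2 / 2).
move=> a0; pose f := (cst (1 + p) + id) * E.
have : f 0 <= f a.
  apply: (@ge0_derive_ge_at0 f (fun x => (p + x) ^+ 2 * E x)) => // x; last first.
    by move=> _; rewrite mulr_ge0 ?sqr_ge0 ?expR_ge0.
  have EE := is_derive_expR_quad (p - 1) x.
  by apply: is_derive_eq; rewrite !fctE /= /GRing.scale/= -/(E x); ring.
have E0 : E 0 = 1 by rewrite /E [X in expR X](_ : _ = 0) ?expR0//; ring.
by rewrite /f !fctE /= E0 addr0 mulr1.
Qed.

(** Hoeffding's bound for the law on -a and a with mean p a. After multiplication by exp a, the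
    difference of the two sides vanishes at a = 0, and [hoeffding_aux] gives the sign of its
    derivative. *)
Lemma cosh_sinh_le (p a : R) : 0 <= a ->
  (1 + p) / 2 * expR a + (1 - p) / 2 * expR (- a) <= expR (p * a + a ^+ 2 / 2).
Proof.
move=> a0.
pose E (y : R) := expR ((p + 1) * y + y ^+ 2 / 2).
pose G (y : R) := expR (2 * y).
pose f := E - cst ((1 + p) / 2) * G.
have : f 0 <= f a.
  apply: (@ge0_derive_ge_at0 f (fun x => (p + 1 + x) * E x - (1 + p) * G x))
    => // x; last first.
    move=> x0; rewrite subr_ge0.
    have -> : E x = G x * expR ((p - 1) * x + x ^+ 2 / 2).
      by rewrite -expRD; congr expR; field.
    rewrite mulrC mulrCA ler_pM2l ?expR_gt0//.
    by rewrite [p + 1]addrC hoeffding_aux.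
  have EE := is_derive_expR_quad (p + 1) x.
  have GG := is_derive_expR_lin 2 x.
  apply: is_derive_eq; rewrite !fctE /= /GRing.scale/= -/(E x) -/(G x); by field.
have E0 : E 0 = 1 by rewrite /E [X in expR X](_ : _ = 0) ?expR0//; ring.
have G0 : G 0 = 1 by rewrite /G mulr0 expR0.
rewrite /f !fctE /= E0 G0 /E /G => H.
have -> : expR (p * a + a ^+ 2 / 2)
   = expR (- a) * expR ((p + 1) * a + a ^+ 2 / 2).
  by rewrite -expRD; congr expR; field.
have -> : expR a = expR (- a) * expR (2 * a) by rewrite -expRD; congr expR; ring.
rewrite mulrCA [_ * expR (- a)]mulrC -mulrDr ler_pM2l ?expR_gt0//.
lra.
Qed.

Lemma expR_mean_le (I : finType) (p : I -> R) (x : I -> R) :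
  (forall i, 0 <= p i) -> \sum_i p i = 1 ->
  expR (\sum_i p i * x i) <= \sum_i p i * expR (x i).
Proof.
move=> p0 p1; set m := \sum_i _.
rewrite -[X in X <= _]mulr1.
(* Jensen by the tangent at the mean: the deviations from [m] average to zero, so the tangent values
   average to 1, and the tangent lies below the exponential. *)
have -> : (1 : R) = \sum_i p i * (1 + (x i - m)).
  under eq_bigr do rewrite mulrDr mulr1 mulrBr.
  by rewrite big_split/= sumrB -/m p1 -mulr_suml p1 mul1r subrr addr0.
rewrite mulr_sumr; apply: ler_sum => i _.
have -> : expR (x i) = expR m * expR (x i - m) by rewrite -expRD; congr expR; ring.
by rewrite mulrCA ler_wpM2l// ler_wpM2l ?expR_ge0// expR_ge1Dx.
Qed.

(* Hoeffding's lemma, by the chord of [expR] over [-a, a]. *)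
Lemma mean_expR_le (I : finType) (p x : I -> R) (a : R) :
  (forall i, 0 <= p i) -> \sum_i p i = 1 -> (forall i, `|x i| <= a) ->
  \sum_i p i * expR (x i) <= expR (\sum_i p i * x i + a ^+ 2 / 2).
Proof.
move=> p0 p1 xa; set m := \sum_i p i * x i.
have a0 : 0 <= a.
  have [i _|I0] := pickP (@predT I); first exact: (le_trans (normr_ge0 (x i)) (xa i)).
  by move: p1; rewrite big1 => [/eqP|i]; [rewrite eq_sym oner_eq0|have := I0 i].
have [az|an0] := eqVneq a 0.
  have xz i : x i = 0 by apply/eqP; rewrite -normr_le0 -az.
  have -> : m = 0 by rewrite /m big1// => i _; rewrite xz mulr0.
  rewrite az expr0n mul0r addr0 expR0 -p1; apply: ler_sum => i _.
  by rewrite xz expR0 mulr1.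
have ap : 0 < a by rewrite lt_neqAle eq_sym an0.
have chord i : expR (x i) <=
    (1 + x i / a) / 2 * expR a + (1 - x i / a) / 2 * expR (- a).
  have := xa i; rewrite ler_norml => /andP[xl xr].
  have u0 : 0 <= (1 + x i / a) / 2.
    by rewrite divr_ge0// -(mulfV an0) -mulrDl divr_ge0//; lra.
  have v0 : 0 <= (1 - x i / a) / 2.
    by rewrite divr_ge0// -(mulfV an0) -mulrBl divr_ge0//; lra.
  pose q (b : bool) := if b then (1 + x i / a) / 2 else (1 - x i / a) / 2.
  pose y (b : bool) := if b then a else - a.
  have q0 b : 0 <= q b by case: b.
  have := expR_mean_le y q0; rewrite !big_bool/= /q /y => H.
  rewrite [X in expR X](_ : _ = (1 + x i / a) / 2 * a + (1 - x i / a) / 2 * - a).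
    by apply: H; field.
  by field.
have -> : m = (m / a) * a by rewrite divfK.
apply: le_trans (cosh_sinh_le _ a0).
apply: (@le_trans _ _ (\sum_i p i * ((1 + x i / a) / 2 * expR a
   + (1 - x i / a) / 2 * expR (- a)))).
  by apply: ler_sum => i _; rewrite ler_wpM2l.
rewrite le_eqVlt; apply/orP; left; apply/eqP.
transitivity (\sum_i (p i * ((expR a + expR (- a)) / 2)
   + p i * x i * ((expR a - expR (- a)) / 2 / a))).
  by apply: eq_bigr => i _; by field.
rewrite big_split/= -!mulr_suml p1 -/m; by field.
Qed.

End ExponentialMoment.

(** * The dual objective *)

Section Marginals.
Variables (R : realType) (m n : nat).
Implicit Type A : 'M[R]_(m, n).

Lemma mulmx_ones A i : (A *m ones R n) i 0 = \sum_j A i j.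
Proof. by rewrite mxE; apply: eq_bigr => j _; rewrite mxE mulr1. Qed.

Lemma trmx_mul_ones A j : (A^T *m ones R m) j 0 = \sum_i A i j.
Proof. by rewrite mxE; apply: eq_bigr => i _; rewrite !mxE mulr1. Qed.

Lemma sum_mulmx_ones A : \sum_i (A *m ones R n) i 0 = \sum_i \sum_j A i j.
Proof. by apply: eq_bigr => i _; rewrite mulmx_ones. Qed.

Lemma sum_trmx_mul_ones A : \sum_j (A^T *m ones R m) j 0 = \sum_i \sum_j A i j.
Proof. by rewrite exchange_big; apply: eq_bigr => i _; rewrite trmx_mul_ones. Qed.

Lemma prob_vec_gt0 k (p : 'cV[R]_k) : prob_vec p -> (0 < k)%N.
Proof.
case: k p => // p [_] /eqP.
by rewrite big_ord0 eq_sym oner_eq0.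
Qed.

Lemma norm1_ge0 k (v : 'cV[R]_k) : 0 <= norm1 v.
Proof. exact: sumr_ge0. Qed.

End Marginals.

Section DualObjective.
Variables (R : realType) (m n : nat) (beta : R) (c : 'M[R]_(m, n)).
Variables (mu : 'cV[R]_m) (nu : 'cV[R]_n).
Hypotheses (beta_gt0 : 0 < beta) (m_gt0 : (0 < m)%N) (n_gt0 : (0 < n)%N).
Implicit Types l d : 'cV[R]_m * 'cV[R]_n.

Local Notation gibbs := (gibbs beta c).
Local Notation f := (dual_obj beta c mu nu).

(** The gradient of [dual_obj] in closed form, as [gradient_dual_obj] shows. *)
Definition marginal_gap l : 'cV[R]_m * 'cV[R]_n :=
  (gibbs l *m ones R n - mu, (gibbs l)^T *m ones R m - nu).

Definition pairing l d : R :=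
  \sum_i l.1 i 0 * d.1 i 0 + \sum_j l.2 j 0 * d.2 j 0.

Lemma pairingZr a l d : pairing l (a *: d) = a * pairing l d.
Proof.
rewrite /pairing mulrDr !mulr_sumr.
by congr (_ + _); apply: eq_bigr => i _; rewrite mxE mulrCA.
Qed.

Definition partition_fun l : R := \sum_i \sum_j gibbs_weight beta c l i j.

Lemma partition_fun_gt0 l : 0 < partition_fun l.
Proof.
rewrite /partition_fun (bigD1 (Ordinal m_gt0))//= (bigD1 (Ordinal n_gt0))//=.
rewrite -addrA ltr_pwDl ?expR_gt0// addr_ge0//.
  by apply: sumr_ge0 => j _; exact: expR_ge0.
by apply: sumr_ge0 => i _; apply: sumr_ge0 => j _; exact: expR_ge0.
Qed.

Lemma gibbsE l i j : gibbs l i j = gibbs_weight beta c l i j / partition_fun l.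
Proof. by rewrite mxE. Qed.

Lemma gibbs_gt0 l i j : 0 < gibbs l i j.
Proof. by rewrite gibbsE divr_gt0 ?expR_gt0 ?partition_fun_gt0. Qed.

Lemma sum_gibbs l : \sum_i \sum_j gibbs l i j = 1.
Proof.
under eq_bigr do under eq_bigr do rewrite gibbsE.
under eq_bigr do rewrite -mulr_suml.
by rewrite -mulr_suml mulfV// gt_eqF// partition_fun_gt0.
Qed.

Lemma sum_gibbs_split l d :
  \sum_i \sum_j gibbs l i j * (d.1 i 0 + d.2 j 0) =
  \sum_i (gibbs l *m ones R n) i 0 * d.1 i 0
  + \sum_j ((gibbs l)^T *m ones R m) j 0 * d.2 j 0.
Proof.
under eq_bigr do under eq_bigr do rewrite mulrDr.
under eq_bigr do rewrite big_split/=.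
rewrite big_split/=; congr (_ + _).
  by apply: eq_bigr => i _; rewrite mulmx_ones mulr_suml.
rewrite exchange_big/=.
by apply: eq_bigr => j _; rewrite trmx_mul_ones mulr_suml.
Qed.

Lemma pairing_marginal_gap l d :
  pairing (marginal_gap l) d =
  \sum_i \sum_j gibbs l i j * (d.1 i 0 + d.2 j 0)
  - \sum_i mu i 0 * d.1 i 0 - \sum_j nu j 0 * d.2 j 0.
Proof.
rewrite sum_gibbs_split /pairing /marginal_gap/=.
under eq_bigr do rewrite mxE [X in _ + X]mxE mulrDl mulNr.
under [X in _ + X = _]eq_bigr do rewrite mxE [X in _ + X]mxE mulrDl mulNr.
rewrite !big_split/= !sumrN; lra.
Qed.

Lemma partition_fun_ratio l l' : partition_fun l' = partition_fun l *
  \sum_i \sum_j gibbs l i j *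
    expR (beta * ((l' - l).1 i 0 + (l' - l).2 j 0)).
Proof.
rewrite mulr_sumr; apply: eq_bigr => i _; rewrite mulr_sumr; apply: eq_bigr => j _.
rewrite gibbsE mulrA mulrCA mulfV ?gt_eqF ?partition_fun_gt0// mulr1 -expRD.
by congr expR; rewrite !mxE; ring.
Qed.

(** Moving to [l'] reweights each cell of the Gibbs matrix at [l], so the logarithm is a cumulant
    under that matrix: Jensen bounds it from below by the mean, Hoeffding from above by the mean
    plus a quadratic term. *)
Lemma dual_objB l l' : f l' - f l =
  beta^-1 * ln (\sum_i \sum_j gibbs l i j *
    expR (beta * ((l' - l).1 i 0 + (l' - l).2 j 0)))
  - \sum_i mu i 0 * (l' - l).1 i 0 - \sum_j nu j 0 * (l' - l).2 j 0.
Proof.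
have P0 : 0 < \sum_i \sum_j gibbs l i j *
    expR (beta * ((l' - l).1 i 0 + (l' - l).2 j 0)).
  by rewrite -(pmulr_rgt0 _ (partition_fun_gt0 l)) -partition_fun_ratio
    partition_fun_gt0.
rewrite /dual_obj -/(partition_fun l') -/(partition_fun l) (partition_fun_ratio l l').
rewrite lnM ?posrE ?partition_fun_gt0//.
have -> : \sum_i mu i 0 * (l' - l).1 i 0 =
    \sum_i mu i 0 * l'.1 i 0 - \sum_i mu i 0 * l.1 i 0.
  by rewrite -sumrB; apply: eq_bigr => i _; rewrite !mxE mulrBr.
have -> : \sum_j nu j 0 * (l' - l).2 j 0 =
    \sum_j nu j 0 * l'.2 j 0 - \sum_j nu j 0 * l.2 j 0.
  by rewrite -sumrB; apply: eq_bigr => i _; rewrite !mxE mulrBr.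
rewrite mulrDr; lra.
Qed.

Lemma dual_obj_convex l l' :
  pairing (marginal_gap l) (l' - l) <= f l' - f l.
Proof.
rewrite dual_objB pairing_marginal_gap !lerD2r.
rewrite ler_pdivlMl// mulr_sumr.
under eq_bigr do rewrite mulr_sumr.
under eq_bigr do under eq_bigr do rewrite mulrCA.
rewrite !pair_bigA/= -ler_expR.
have H := @expR_mean_le R ('I_m * 'I_n)%type (fun p => gibbs l p.1 p.2)
  (fun p => beta * ((l' - l).1 p.1 0 + (l' - l).2 p.2 0)).
have E := H (fun p => ltW (gibbs_gt0 l p.1 p.2)) _.
rewrite lnK; first by apply: E; rewrite -pair_bigA sum_gibbs.
by rewrite posrE; apply: lt_le_trans (E _); rewrite ?expR_gt0// -pair_bigA sum_gibbs.
Qed.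

Lemma dual_obj_smooth l l' (a b : R) :
  (forall i, `|(l' - l).1 i 0| <= a) -> (forall j, `|(l' - l).2 j 0| <= b) ->
  f l' - f l <= pairing (marginal_gap l) (l' - l) + beta / 2 * (a + b) ^+ 2.
Proof.
move=> la lb.
rewrite dual_objB pairing_marginal_gap.
rewrite [leRHS]addrAC lerD2r [leRHS]addrAC lerD2r.
rewrite ler_pdivrMl// mulrDr mulr_sumr.
under [X in _ <= X + _]eq_bigr do rewrite mulr_sumr.
under [X in _ <= X + _]eq_bigr do under eq_bigr do rewrite mulrCA.
rewrite !pair_bigA/=.
have -> : beta * (beta / 2 * (a + b) ^+ 2) = (beta * (a + b)) ^+ 2 / 2 by field.
have p1 : \sum_(p : 'I_m * 'I_n) gibbs l p.1 p.2 = 1 by rewrite -pair_bigA sum_gibbs.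
have p0 (p : 'I_m * 'I_n) : 0 <= gibbs l p.1 p.2 by rewrite ltW ?gibbs_gt0.
pose x (p : 'I_m * 'I_n) := beta * ((l' - l).1 p.1 0 + (l' - l).2 p.2 0).
have xa p : `|x p| <= beta * (a + b).
  rewrite normrM gtr0_norm// ler_pM2l//.
  by apply: le_trans (ler_normD _ _) _; rewrite lerD.
rewrite -ler_expR lnK; first exact: mean_expR_le p0 p1 xa.
by rewrite posrE; apply: lt_le_trans (expR_mean_le x p0 p1); rewrite expR_gt0.
Qed.

(** Convexity and smoothness enclose f(l + h d) - f(l) - h p between 0 and C h^2, where p is the
    pairing with the gap, so the difference quotient tends to p. *)
Lemma derive_dual_obj l d : 'D_d f l = pairing (marginal_gap l) d.
Proof.
pose C := beta / 2 * (norm1 d.1 + norm1 d.2) ^+ 2.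
have C0 : 0 <= C by rewrite mulr_ge0 ?sqr_ge0// divr_ge0// ltW.
apply: cvg_lim => //.
apply/cvgrPdist_le => e e0; near=> h.
have h0 : h != 0 by near: h; exact: nbhs_dnbhs_neq.
have entry_le k (v : 'cV[R]_k) i : `|(h *: v) i 0| <= `|h| * norm1 v.
  by rewrite mxE normrM ler_wpM2l// /norm1 (bigD1 i)//= lerDl sumr_ge0.
have D : h *: d + l - l = h *: d by rewrite addrK.
have := dual_obj_convex l (h *: d + l).
rewrite D pairingZr => lo.
have := @dual_obj_smooth l (h *: d + l) (`|h| * norm1 d.1) (`|h| * norm1 d.2).
rewrite D pairingZr => /(_ (entry_le _ _) (entry_le _ _)) hi.
set p := pairing _ _ in lo hi *; set q := f (_ + _) - _ in lo hi *.
have {}hi : q - h * p <= `|h| ^+ 2 * C by rewrite /C; lra.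
have -> : p - h^-1 *: ((f \o shift l) (h *: d) - f l) = - (h^-1 * (q - h * p)).
  by rewrite /= /GRing.scale/= -/q; field.
rewrite normrN normrM normfV ler_pdivrMl ?normr_gt0// ger0_norm ?subr_ge0//.
apply: le_trans hi _; rewrite expr2 -mulrA ler_wpM2l//.
(* [C] vanishes for a null direction, hence the added 1. *)
have : `|h| <= e / (C + 1).
  by near: h; apply: dnbhs0_le; rewrite divr_gt0// ltr_wpDl.
rewrite ler_pdivlMr ?ltr_wpDl// mulrDr mulr1 => H.
by apply: le_trans H; rewrite lerDl.
Unshelve. all: by end_near. Qed.

Lemma gradient_dual_obj l : gradient f l = marginal_gap l.
Proof.
congr pair; apply/matrixP => i k; rewrite (ord1 k) mxE derive_dual_obj /pairing/=.
  rewrite [X in _ + X]big1 ?addr0 => [|j _]; last by rewrite [X in _ * X]mxE mulr0.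
  rewrite (bigD1 i)//= big1 ?addr0 => [|j /negbTE ji]; last by rewrite [X in _ * X]mxE ji mulr0.
  by rewrite [X in _ * X]mxE !eqxx mulr1.
rewrite [X in X + _]big1 ?add0r => [|j _]; last by rewrite [X in _ * X]mxE mulr0.
rewrite (bigD1 i)//= big1 ?addr0 => [|j /negbTE ji]; last by rewrite [X in _ * X]mxE ji mulr0.
by rewrite [X in _ * X]mxE !eqxx mulr1.
Qed.

End DualObjective.

(** [delta] is an objective gap, [q] the squared gradient norm, [D] a diameter. Eliminating [q]
    gives delta_(k+1) <= delta_k - delta_k^2 / A with A = 2 D^2 / eta, so k delta_k <= A. The
    decreases after step k, each at least eta G^2 / 2, sum to at most delta_k. With k and T + 1 - k
    both at least (T - 1) / 2 this yields ((T - 1) / 2)^2 eta G^2 / 2 <= A. *)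
Lemma sublinear_rate (R : realType) (delta q : nat -> R) (D eta G : R) (T : nat) :
  0 < D -> 0 < eta -> 0 <= G -> (2 <= T)%N ->
  (forall t, (t <= T.+1)%N -> 0 <= delta t) ->
  (forall t, (t <= T)%N -> delta t ^+ 2 <= D ^+ 2 * q t) ->
  (forall t, (t <= T)%N -> delta t.+1 <= delta t - eta / 2 * q t) ->
  (forall t, (1 <= t <= T)%N -> G ^+ 2 <= q t) ->
  G <= 4 * D / ((T%:R - 1) * eta).
Proof.
move=> D0 e0 G0 T2 d0 dq dd Gq.
pose A := 2 * D ^+ 2 / eta.
have A0 : 0 < A by rewrite divr_gt0// mulr_gt0// exprn_gt0.
have q_ge t : (t <= T)%N -> delta t ^+ 2 / A <= eta / 2 * q t.
  move=> tT; have -> : delta t ^+ 2 / A = eta / 2 * (delta t ^+ 2 / D ^+ 2).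
    by rewrite /A; field; rewrite !gt_eqF.
  rewrite ler_pM2l ?divr_gt0// ler_pdivrMr ?exprn_gt0// mulrC; exact: dq.
have rate k : (k <= T.+1)%N -> k%:R * delta k <= A.
  elim: k => [_|k IH kT]; first by rewrite mul0r ltW.
  have {}IH := IH (ltnW kT).
  have dk0 := d0 k (ltnW kT); have dk10 := d0 k.+1 kT.
  have step : delta k.+1 <= delta k - delta k ^+ 2 / A.
    by apply: le_trans (dd k kT) _; rewrite lerD2l lerN2 q_ge.
  (* Division-free form of 1 / delta_(k+1) >= 1 / delta_k + 1 / A. *)
  have step' : delta k.+1 * (A + delta k) <= A * delta k.
    apply: (@le_trans _ _ ((delta k - delta k ^+ 2 / A) * (A + delta k))).
      by rewrite ler_wpM2r// addr_ge0// ltW.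
    have -> : (delta k - delta k ^+ 2 / A) * (A + delta k)
      = A * delta k - delta k ^+ 3 / A by field; rewrite gt_eqF.
    by rewrite gerBl divr_ge0 ?exprn_ge0// ltW.
  have [dk|dk] := eqVneq (delta k) 0.
    have -> : delta k.+1 = 0.
      apply/eqP; rewrite eq_le dk10 andbT; move: step.
      by rewrite dk expr0n mul0r subrr.
    by rewrite mulr0 ltW.
  have dkp : 0 < delta k by rewrite lt_neqAle eq_sym dk.
  rewrite -(ler_pM2r dkp); apply: le_trans step'.
  have -> : k.+1%:R * delta k.+1 * delta k = delta k.+1 * (k%:R * delta k + delta k).
    by rewrite -natr1; ring.
  by rewrite ler_wpM2l// lerD2r.
(* T >= 2 makes [k] at least 1, so the second half avoids iterate 0, for which [G] is no lower
   bound. *)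
pose k := T./2.
have k1 : (1 <= k)%N by rewrite /k; lia.
have kT : (k <= T)%N by rewrite /k; lia.
have tail j : (k + j <= T.+1)%N -> j%:R * (eta / 2 * G ^+ 2) <= delta k - delta (k + j)%N.
  elim: j => [_|j IH kj]; first by rewrite mul0r addn0 subrr.
  have {}IH := IH (ltnW (eq_ind _ (fun x => (x <= T.+1)%N) kj _ (addnS k j))).
  have kjT : (k + j <= T)%N by rewrite -ltnS -addnS.
  have := dd _ kjT.
  have : eta / 2 * G ^+ 2 <= eta / 2 * q (k + j)%N.
    by rewrite ler_pM2l ?divr_gt0// Gq// kjT andbT (leq_trans k1)// leq_addr.
  rewrite addnS -[j.+1%:R]natr1 mulrDl mul1r; lra.
have := tail (T.+1 - k)%N; rewrite subnKC ?(leq_trans kT)// => /(_ (leqnn _)) H1.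
have H2 := rate k (leq_trans kT (leqnSn _)).
have H3 := d0 T.+1 (leqnn _).
have kR : (T%:R - 1) / 2 <= k%:R :> R.
  rewrite ler_pdivrMr// lerBlDr -natrM natr1 ler_nat /k; lia.
have TkR : (T%:R - 1) / 2 <= (T.+1 - k)%:R :> R.
  rewrite ler_pdivrMr// lerBlDr -natrM natr1 ler_nat /k; lia.
have T1 : 0 < T%:R - 1 :> R by rewrite subr_gt0 ltr1n.
have H4 : ((T%:R - 1) / 2) ^+ 2 * (eta / 2 * G ^+ 2) <= A.
  have X0 : 0 <= eta / 2 * G ^+ 2 by rewrite mulr_ge0 ?sqr_ge0// divr_ge0// ltW.
  apply: le_trans H2; rewrite expr2 -mulrA.
  apply: ler_pM => //; [by rewrite divr_ge0// ltW| |].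
    by rewrite mulr_ge0// divr_ge0// ltW.
  apply: (@le_trans _ _ ((T.+1 - k)%:R * (eta / 2 * G ^+ 2))).
    by rewrite ler_wpM2r.
  by apply: le_trans H1 _; rewrite gerBl.
have P0 : 0 < (T%:R - 1) * eta by rewrite mulr_gt0.
rewrite ler_pdivlMr// -ler_sqr ?nnegrE ?mulr_ge0 ?(ltW D0) ?(ltW P0)// ?mulr_ge0 ?(ltW T1) ?(ltW e0)//.
have -> : (G * ((T%:R - 1) * eta)) ^+ 2 =
   8 * eta * (((T%:R - 1) / 2) ^+ 2 * (eta / 2 * G ^+ 2)) by field.
have -> : (4 * D) ^+ 2 = 8 * eta * A by rewrite /A; field; rewrite gt_eqF.
by rewrite ler_pM2l// mulr_gt0.
Qed.

(** * The ascent *)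

Section Transposition.
Variables (R : realType) (m n : nat) (beta : R) (c : 'M[R]_(m, n)).
Variables (mu : 'cV[R]_m) (nu : 'cV[R]_n).
Implicit Type l : 'cV[R]_m * 'cV[R]_n.

Lemma gibbs_weight_tr l i j :
  gibbs_weight beta c^T (l.2, l.1) j i = gibbs_weight beta c l i j.
Proof. by rewrite /gibbs_weight/= mxE; congr expR; ring. Qed.

Lemma partition_fun_tr l : partition_fun beta c^T (l.2, l.1) = partition_fun beta c l.
Proof.
rewrite /partition_fun exchange_big; apply: eq_bigr => i _.
by apply: eq_bigr => j _; rewrite gibbs_weight_tr.
Qed.

Lemma gibbs_tr l : gibbs beta c^T (l.2, l.1) = (gibbs beta c l)^T.
Proof.
apply/matrixP => j i; rewrite [RHS]mxE !gibbsE partition_fun_tr.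
by rewrite gibbs_weight_tr.
Qed.

Lemma dual_obj_tr l : dual_obj beta c^T nu mu (l.2, l.1) = dual_obj beta c mu nu l.
Proof.
rewrite /dual_obj -/(partition_fun beta c^T (l.2, l.1)) partition_fun_tr/=.
by congr (_ + _); rewrite addrC [- _ - _]addrC; lra.
Qed.

End Transposition.

(** Oscillation is unchanged by adding a constant to [v], which is exactly what [mean_shift]
    does. *)
Definition spread_le (R : realType) k (v : 'cV[R]_k) (B : R) :=
  forall i i', v i' 0 - v i 0 <= B.

(** * Row marginals and the Sinkhorn update *)

Section RowMarginal.
Variables (R : realType) (m n : nat) (beta : R) (c : 'M[R]_(m, n)).
Variables (M s : R).
Hypotheses (beta_gt0 : 0 < beta) (m_gt0 : (0 < m)%N) (n_gt0 : (0 < n)%N).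
Hypotheses (s_gt0 : 0 < s) (cM : forall i j, `|c i j| <= M).
Implicit Type l : 'cV[R]_m * 'cV[R]_n.

(** The lag at which exp (beta * (2 * M - lag)) equals [s]. *)
Definition spread_bound := 2 * M + ln (1 / s) / beta.

Local Notation rowm l := (gibbs beta c l *m ones R n).

Lemma row_marginal_le1 l i : rowm l i 0 <= 1.
Proof.
rewrite -(sum_gibbs beta c m_gt0 n_gt0 l) mulmx_ones [leRHS](bigD1 i)//= lerDl.
by apply: sumr_ge0 => i' _; apply: sumr_ge0 => j _; rewrite ltW// gibbs_gt0.
Qed.

(** Within a column the potential of that column cancels between two rows, and two costs differ by
    at most 2 M. *)
Lemma row_marginal_ratio l i i' :
  rowm l i 0 <= expR (beta * (l.1 i 0 - l.1 i' 0 + 2 * M)) * rowm l i' 0.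
Proof.
rewrite !mulmx_ones mulr_sumr; apply: ler_sum => j _.
rewrite !gibbsE mulrA ler_pM2r ?invr_gt0 ?partition_fun_gt0//.
rewrite -expRD ler_expR; set z := 2 * M.
have -> : - beta * (c i j - l.1 i 0 - l.2 j 0) =
  beta * (l.1 i 0 - l.1 i' 0 + (c i' j - c i j))
   + - beta * (c i' j - l.1 i' 0 - l.2 j 0) by ring.
rewrite lerD2r ler_pM2l// lerD2l /z.
have := cM i j; have := cM i' j; rewrite !ler_norml; lra.
Qed.

Lemma row_marginal_lt l i i' :
  spread_bound < l.1 i' 0 - l.1 i 0 -> rowm l i 0 < s.
Proof.
move=> far; apply: le_lt_trans (row_marginal_ratio l i i') _.
apply: (@le_lt_trans _ _ (expR (beta * (l.1 i 0 - l.1 i' 0 + 2 * M)))).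
  by rewrite -[leRHS]mulr1 ler_pM2l ?expR_gt0// row_marginal_le1.
rewrite -[ltRHS]lnK ?posrE// ltr_expR -ltr_pdivlMl//.
by move: far; rewrite /spread_bound div1r lnV ?posrE//; lra.
Qed.

(** With the second block fixed, [phi] is chosen so that the row sums of the weights equal [mu]. The
    row gap then vanishes and the other block does not move, so the convexity bound taken at the new
    point is zero. The spread follows because a row lagging by more than [spread_bound] would have
    marginal below [s], whereas it is now an entry of [mu]. *)
Lemma sinkhorn_row (mu : 'cV[R]_m) (nu : 'cV[R]_n) (l : 'cV[R]_m * 'cV[R]_n) :
  \sum_i mu i 0 = 1 -> (forall i, s <= mu i 0) ->
  exists phi, dual_obj beta c mu nu (phi, l.2) <= dual_obj beta c mu nu l
    /\ spread_le phi spread_bound.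
Proof.
move=> mu1 mus.
have mu0 i : 0 < mu i 0 by exact: lt_le_trans (mus i).
pose e i j := expR (- beta * (c i j - l.2 j 0)).
have e0 i : 0 < \sum_j e i j.
  rewrite (bigD1 (Ordinal n_gt0))//= ltr_pwDl ?expR_gt0//.
  by apply: sumr_ge0 => j _; exact: expR_ge0.
pose phi : 'cV[R]_m := \col_i (beta^-1 * (ln (mu i 0) - ln (\sum_j e i j))).
pose l' := (phi, l.2).
have wE i j : gibbs_weight beta c l' i j = mu i 0 * e i j / \sum_j e i j.
  have -> : mu i 0 * e i j / (\sum_j e i j) =
    expR (ln (mu i 0)) * e i j / expR (ln (\sum_j e i j)) by rewrite !lnK ?posrE.
  rewrite /gibbs_weight /e -expRN -!expRD; congr expR.
  by rewrite /l' /= mxE; field; rewrite gt_eqF.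
have rowE i : \sum_j gibbs_weight beta c l' i j = mu i 0.
  under eq_bigr do rewrite wE.
  by rewrite -mulr_suml -mulr_sumr mulfK// gt_eqF.
have Z1 : partition_fun beta c l' = 1.
  by rewrite /partition_fun; under eq_bigr do rewrite rowE.
have rE i : rowm l' i 0 = mu i 0.
  rewrite mulmx_ones -[RHS]rowE; apply: eq_bigr => j _.
  by rewrite gibbsE Z1 divr1.
exists phi; split; last first.
  move=> i i'; rewrite leNgt; apply/negP => /(row_marginal_lt (l := l')).
  by rewrite rE ltNge mus.
rewrite -/l' -subr_ge0; apply: le_trans (dual_obj_convex c mu nu beta_gt0 m_gt0 n_gt0 l' l).
rewrite /pairing/= !big1 ?addr0// => [j _|i _].
  have -> : (l.2 - l.2) j 0 = 0 by rewrite !mxE subrr.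
  by rewrite mulr0.
have -> : (rowm l' - mu) i 0 = 0 by rewrite mxE [X in _ + X]mxE rE subrr.
by rewrite mul0r.
Qed.

End RowMarginal.

(** * Descent and spread of the iterates *)

Section Ascent.
Variables (R : realType) (m n : nat) (beta eta : R) (c : 'M[R]_(m, n)).
Variables (mu : 'cV[R]_m) (nu : 'cV[R]_n) (M s : R).
Hypotheses (inst : ot_instance mu nu c M s).
Hypotheses (beta_gt0 : 0 < beta) (eta_gt0 : 0 < eta) (eta_le : eta <= 1 / beta).
Implicit Types l d : 'cV[R]_m * 'cV[R]_n.

Local Notation gibbs := (gibbs beta c).
Local Notation f := (dual_obj beta c mu nu).
Local Notation gap := (marginal_gap beta c mu nu).
Local Notation step := (ascent_step beta eta c mu nu).
Local Notation B := (spread_bound beta M s).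

Let mu_ge0 i : 0 <= mu i 0. Proof. by case: inst => -[[]]. Qed.
Let nu_ge0 i : 0 <= nu i 0. Proof. by case: inst => -[_ []]. Qed.
Let mu1 : \sum_i mu i 0 = 1. Proof. by case: inst => -[[]]. Qed.
Let nu1 : \sum_j nu j 0 = 1. Proof. by case: inst => -[_ []]. Qed.
Let m_gt0 : (0 < m)%N. Proof. by case: inst => -[/prob_vec_gt0]. Qed.
Let n_gt0 : (0 < n)%N. Proof. by case: inst => -[_ /prob_vec_gt0]. Qed.
Let s_gt0 : 0 < s. Proof. by case: inst => -[]. Qed.
Let mu_ge i : s <= mu i 0. Proof. by case: inst => _ []. Qed.
Let nu_ge j : s <= nu j 0. Proof. by case: inst => _ []. Qed.
Let cM i j : `|c i j| <= M. Proof. by case: inst => _ []. Qed.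
Let M_gt0 : 0 < M. Proof. by case: inst => -[]. Qed.
Let ln_s_ge0 : 0 <= ln (1 / s).
Proof.
have s1 : s <= 1.
  apply: le_trans (mu_ge (Ordinal m_gt0)) _.
  by rewrite -mu1 (bigD1 (Ordinal m_gt0))//= lerDl sumr_ge0.
by rewrite ln_ge0// ler_pdivlMr// mul1r.
Qed.
Let beta_eta : beta * eta <= 1.
Proof. by rewrite mulrC -ler_pdivlMr. Qed.

Lemma sum_marginal_gap l :
  \sum_i (gap l).1 i 0 = 0 /\ \sum_j (gap l).2 j 0 = 0.
Proof.
rewrite /marginal_gap/=.
under eq_bigr do rewrite mxE [X in _ + X]mxE.
under [X in _ /\ X = _]eq_bigr do rewrite mxE [X in _ + X]mxE.
by rewrite !sumrB sum_mulmx_ones sum_trmx_mul_ones sum_gibbs// mu1 nu1 subrr.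
Qed.

Lemma norm1_marginal_gap l : norm1 (gap l).1 <= 2 /\ norm1 (gap l).2 <= 2.
Proof.
have p0 i j := ltW (gibbs_gt0 beta c m_gt0 n_gt0 l i j).
split.
  apply: (@le_trans _ _ (\sum_i ((gibbs l *m ones R n) i 0 + mu i 0))).
    apply: ler_sum => i _; rewrite mxE [X in _ + X]mxE.
    apply: le_trans (ler_normB _ _) _.
    by rewrite mulmx_ones !ger0_norm// sumr_ge0.
  by rewrite big_split/= sum_mulmx_ones sum_gibbs// mu1.
apply: (@le_trans _ _ (\sum_j (((gibbs l)^T *m ones R m) j 0 + nu j 0))).
  apply: ler_sum => i _; rewrite mxE [X in _ + X]mxE.
  apply: le_trans (ler_normB _ _) _.
  by rewrite trmx_mul_ones !ger0_norm// sumr_ge0.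
by rewrite big_split/= sum_trmx_mul_ones sum_gibbs// nu1.
Qed.

Lemma mean_shiftE k (v : 'cV[R]_k) i :
  mean_shift v i 0 = v i 0 - k%:R^-1 * \sum_i v i 0.
Proof. by rewrite !mxE mulr1. Qed.

Lemma sign_stepE k (g : 'cV[R]_k) i :
  sign_step eta g i 0 = eta / 2 * norm1 g * Num.sg (g i 0).
Proof. by rewrite !mxE. Qed.

Lemma sg_le1 (x : R) : `|Num.sg x| <= 1.
Proof. by case: sgrP => _; rewrite ?normr0 ?normrN ?normr1. Qed.

(* An entry lagging far behind has a negative gap, hence moves up by the full
   step length, so no pair can drift further apart. *)
Lemma spread_sign_step k (v g : 'cV[R]_k) :
  spread_le v (B + 2 / beta) -> norm1 g <= 2 ->
  (forall i i', B < v i' 0 - v i 0 -> g i 0 < 0) ->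
  spread_le (mean_shift (v - sign_step eta g)) (B + 2 / beta).
Proof.
move=> vB g2 gneg i i'; rewrite !mean_shiftE.
set mean := _ * \sum_i _.
have wE j : (v - sign_step eta g) j 0 = v j 0 - eta / 2 * norm1 g * Num.sg (g j 0).
  by rewrite mxE [X in _ + X]mxE sign_stepE.
rewrite !wE {wE}.
set a := eta / 2 * norm1 g.
have a0 : 0 <= a by rewrite mulr_ge0 ?norm1_ge0// divr_ge0// ltW.
(* As the gap has norm at most 2, the step length [a] is at most [eta]. A pair within [B] separates
   by at most 2 a, which the slack 2 / beta of the invariant absorbs. *)
have ab : a <= 1 / beta.
  apply: le_trans eta_le; rewrite /a -mulrA ger_pMr//.
  by rewrite ler_pdivrMl// mulr1.
have := sg_le1 (g i 0); have := sg_le1 (g i' 0).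
rewrite !ler_norml => /andP[A1 A2] /andP[A3 A4].
have [far|near] := ltP B (v i' 0 - v i 0).
  have := vB i i'; rewrite (ltr0_sg (gneg _ _ far)).
  have : 0 <= a * (Num.sg (g i' 0) + 1) by rewrite mulr_ge0//; lra.
  rewrite mulrDr mulr1; lra.
have : a * (Num.sg (g i 0) - Num.sg (g i' 0)) <= a * 2 by rewrite ler_wpM2l//; lra.
rewrite mulrBr; lra.
Qed.

Lemma iterate_spread t : let l := iterate beta eta c mu nu t in
  spread_le l.1 (B + 2 / beta) /\ spread_le l.2 (B + 2 / beta).
Proof.
elim: t => [|t] /=.
  have B0 : 0 <= B + 2 / beta.
    have b0 := ltW beta_gt0.
    rewrite addr_ge0 ?divr_ge0// addr_ge0 ?mulr_ge0 ?(ltW M_gt0) ?invr_ge0//.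
  by split=> i i' /=; rewrite !mxE subrr.
move: (iterate _ _ _ _ _ _) => l [l1 l2].
have [g1 g2] := norm1_marginal_gap l.
split; apply: spread_sign_step => // i i' far.
  rewrite mxE [X in _ + X]mxE subr_lt0.
  exact: lt_le_trans (row_marginal_lt beta_gt0 m_gt0 n_gt0 s_gt0 cM far) (mu_ge i).
rewrite mxE [X in _ + X]mxE subr_lt0 -gibbs_tr.
apply: lt_le_trans (nu_ge i); apply: (@row_marginal_lt _ _ _ _ c^T M s _ _ _ _ _ (l.2, l.1)) far => //.
by move=> j k; rewrite mxE.
Qed.

(** A zero-sum gap does not see constants, so a reference entry may be subtracted from each block of
    [d] and oscillation replaces size. *)
Lemma pairing_spread l d (K : R) :
  (forall i i', `|d.1 i 0 - d.1 i' 0| <= K) ->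
  (forall i i', `|d.2 i 0 - d.2 i' 0| <= K) ->
  pairing (gap l) d <= K * (norm1 (gap l).1 + norm1 (gap l).2).
Proof.
have side k (g v : 'cV[R]_k) : (0 < k)%N -> \sum_i g i 0 = 0 ->
  (forall i i', `|v i 0 - v i' 0| <= K) -> \sum_i g i 0 * v i 0 <= K * norm1 g.
  move=> k0 g0 vK; pose i0 := Ordinal k0.
  have -> : \sum_i g i 0 * v i 0 = \sum_i g i 0 * (v i 0 - v i0 0).
    under [RHS]eq_bigr do rewrite mulrBr.
    by rewrite sumrB -mulr_suml g0 mul0r subr0.
  rewrite mulr_sumr; apply: ler_sum => i _.
  apply: le_trans (ler_norm _) _; rewrite normrM mulrC.
  by rewrite ler_wpM2r.
move=> d1 d2; have [g1 g2] := sum_marginal_gap l.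
by rewrite mulrDr lerD// side.
Qed.

(** Accounts for the recentring in [ascent_step]: a blockwise constant has oscillation K = 0, so it
    pairs to at most 0 with the gap at [l + d], which is the slope that convexity asks for. *)
Lemma dual_obj_shift l d :
  (forall i i', d.1 i 0 = d.1 i' 0) -> (forall j j', d.2 j 0 = d.2 j' 0) ->
  f (l + d) <= f l.
Proof.
move=> d1 d2; rewrite -subr_ge0.
apply: le_trans (dual_obj_convex c mu nu beta_gt0 m_gt0 n_gt0 (l + d) l).
rewrite opprD addNKr -subr_le0 sub0r.
have -> : - pairing (gap (l + d)) (- d) = pairing (gap (l + d)) d.
  by rewrite -[- d]scaleN1r pairingZr mulN1r opprK.
rewrite -(mul0r (norm1 (gap (l + d)).1 + norm1 (gap (l + d)).2)).
apply: pairing_spread => i i'; first by rewrite (d1 i i') subrr normr0.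
by rewrite (d2 i i') subrr normr0.
Qed.

(** The signed step is steepest descent for the sup norm of each block. With x and y the norms of
    the two gaps, its linear gain is eta / 2 (x^2 + y^2). The quadratic loss is beta eta^2 / 8 (x +
    y)^2, at most half of the gain because beta eta <= 1 and (x + y)^2 <= 2 (x^2 + y^2). *)
Lemma ascent_step_descent l :
  f (step l) <= f l - eta / 2 * (2^-1 * (norm1 (gap l).1 ^+ 2 + norm1 (gap l).2 ^+ 2)).
Proof.
pose d := (- sign_step eta (gap l).1, - sign_step eta (gap l).2).
apply: (@le_trans _ _ (f (l + d))).
  pose e : 'cV[R]_m * 'cV[R]_n :=
    (- ((m%:R^-1 * \sum_i (l + d).1 i 0) *: ones R m),
     - ((n%:R^-1 * \sum_j (l + d).2 j 0) *: ones R n)).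
  have -> : step l = l + d + e by [].
  by apply: dual_obj_shift => i i'; rewrite !mxE.
have lB : l + d - l = d by rewrite addrAC subrr add0r.
set x := norm1 _; set y := norm1 _.
have x0 : 0 <= x by exact: norm1_ge0.
have y0 : 0 <= y by exact: norm1_ge0.
have bound k (g : 'cV[R]_k) i : `|(- sign_step eta g) i 0| <= eta / 2 * norm1 g.
  have h : 0 <= eta / 2 * norm1 g by rewrite mulr_ge0 ?norm1_ge0// divr_ge0// ltW.
  rewrite mxE normrN sign_stepE normrM ger0_norm//.
  by rewrite -[leRHS]mulr1 ler_wpM2l ?sg_le1.
have := dual_obj_smooth c mu nu beta_gt0 m_gt0 n_gt0 (l := l) (l' := l + d)
  (a := eta / 2 * x) (b := eta / 2 * y).
rewrite lB => /(_ (bound _ _) (bound _ _)).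
have side k (g : 'cV[R]_k) :
    \sum_i g i 0 * (- sign_step eta g) i 0 = - (eta / 2) * norm1 g ^+ 2.
  rewrite expr2 mulrA {2}/norm1 mulr_sumr; apply: eq_bigr => i _.
  by rewrite mxE sign_stepE mulrN mulrCA [g i 0 * _]mulrC -normrEsg !mulNr.
rewrite /pairing !side -/x -/y -mulrDr => H.
suff : beta / 2 * (eta / 2 * x + eta / 2 * y) ^+ 2 <= eta / 4 * (x ^+ 2 + y ^+ 2) by lra.
have -> : beta / 2 * (eta / 2 * x + eta / 2 * y) ^+ 2 =
  (beta * eta) * (eta / 8 * (x + y) ^+ 2) by field.
apply: (@le_trans _ _ (eta / 8 * (x + y) ^+ 2)).
  by rewrite -[leRHS]mul1r ler_wpM2r// mulr_ge0 ?sqr_ge0// divr_ge0// ltW.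
have -> : eta / 4 * (x ^+ 2 + y ^+ 2) = eta / 8 * ((x + y) ^+ 2 + (x - y) ^+ 2) by field.
by rewrite ler_pM2l ?divr_gt0// lerDl sqr_ge0.
Qed.

Lemma best_iterate_gap T tt : (2 <= T)%N -> best_iterate beta eta c mu nu T tt ->
  norm1 (gap (iterate beta eta c mu nu tt)).1
  + norm1 (gap (iterate beta eta c mu nu tt)).2
  <= 32 * (2 * M + (ln (1 / s) + 1) / beta) / ((T%:R - 1) * eta).
Proof.
move=> T2 [ttT ttmin]; set g := gap _.
pose lam := iterate beta eta c mu nu.
pose W := 2 * M + (ln (1 / s) + 1) / beta.
pose q t := 2^-1 * (norm1 (gap (lam t)).1 ^+ 2 + norm1 (gap (lam t)).2 ^+ 2).
have q0 t : 0 <= q t by rewrite mulr_ge0 ?invr_ge0// addr_ge0// sqr_ge0.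
have gradE t : iterate_grad_norm beta eta c mu nu t = Num.sqrt (q t).
  by rewrite /iterate_grad_norm gradient_dual_obj.
(* The update starts from iterate [T.+1], the last one whose gap [sublinear_rate] requires to be
   nonnegative. Columns are updated after rows; this leaves [phi] alone, so both blocks have spread
   at most [B]. *)
have [phi [fphi sphi]] := sinkhorn_row beta_gt0 m_gt0 n_gt0 s_gt0 cM nu
  (lam T.+1) mu1 mu_ge.
have [psi [fpsi spsi]] : exists psi, f (phi, psi) <= f (phi, (lam T.+1).2)
    /\ spread_le psi B.
  have [|psi [fpsi spsi]] := @sinkhorn_row _ _ _ _ c^T M s beta_gt0 n_gt0 m_gt0 s_gt0
    _ nu mu ((lam T.+1).2, phi) nu1 nu_ge.
    by move=> j i; rewrite mxE.
  exists psi; split; last exact: spsi.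
  move: fpsi.
  by rewrite -[f (phi, psi)]dual_obj_tr -[f (phi, _)]dual_obj_tr.
pose l' := (phi, psi).
pose delta t := f (lam t) - f l'.
have dd t : delta t.+1 <= delta t - eta / 2 * q t.
  have H : f (lam t.+1) <= f (lam t) - eta / 2 * q t by exact: ascent_step_descent.
  by rewrite /delta [leRHS]addrAC lerD2r.
have mono t : f (lam t.+1) <= f (lam t).
  apply: le_trans (ascent_step_descent (lam t)) _.
  by rewrite gerBl mulr_ge0 ?q0// divr_ge0// ltW.
have d0 t : (t <= T.+1)%N -> 0 <= delta t.
  move=> tT; rewrite subr_ge0; apply: le_trans fpsi (le_trans fphi _).
  rewrite -(subnKC tT); elim: (T.+1 - t)%N => [|j IH]; first by rewrite addn0.
  by rewrite addnS; exact: le_trans (mono _) IH.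
have W0 : 0 < W.
  by rewrite addr_gt0 ?mulr_gt0 ?invr_gt0// ltr_wpDl.
have dq t : (t <= T)%N -> delta t ^+ 2 <= (4 * W) ^+ 2 * q t.
  move=> tT; set x := norm1 (gap (lam t)).1; set y := norm1 (gap (lam t)).2.
  have H : delta t <= 2 * W * (x + y).
    rewrite /delta -opprB; apply: le_trans (_ : pairing (gap (lam t)) (lam t - l') <= _).
      have := dual_obj_convex c mu nu beta_gt0 m_gt0 n_gt0 (lam t) l'.
      rewrite -[l' - lam t]opprB -[- (lam t - l')]scaleN1r pairingZr mulN1r; lra.
    have [s1 s2] := iterate_spread t.
    (* The comparison point contributes [B], the iterate [B + 2 / beta]. *)
    have -> : 2 * W = B + (B + 2 / beta) by rewrite /W /spread_bound; lra.
    have close k (v w : 'cV[R]_k) : spread_le v (B + 2 / beta) -> spread_le w B ->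
        forall i i', `|(v - w) i 0 - (v - w) i' 0| <= B + (B + 2 / beta).
      move=> sv sw i i'.
      have E j : (v - w) j 0 = v j 0 - w j 0 by rewrite mxE [X in _ + X]mxE.
      rewrite !E ler_norml.
      by have := sv i i'; have := sv i' i; have := sw i i'; have := sw i' i; lra.
    by apply: pairing_spread; apply: close.
  (* Passing from x + y to the Euclidean combination [q] costs a factor 2, hence the diameter 4
     W. *)
  have xy : (x + y) ^+ 2 <= 4 * q t.
    have := sqr_ge0 (x - y); rewrite /q -/x -/y !expr2; nra.
  apply: (@le_trans _ _ ((2 * W * (x + y)) ^+ 2)).
    rewrite ler_sqr ?nnegrE// ?d0 1?ltnW//.
    by rewrite !mulr_ge0 ?(ltW W0)// addr_ge0 ?norm1_ge0.
  have -> : (4 * W) ^+ 2 * q t = (2 * W) ^+ 2 * (4 * q t) by ring.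
  by rewrite exprMn ler_wpM2l ?sqr_ge0.
pose G := Num.sqrt (q tt).
have GE : G ^+ 2 = q tt by rewrite sqr_sqrtr.
have := sublinear_rate (delta := delta) (q := q) (D := 4 * W) (eta := eta) (G := G) (T := T).
move=> /(_ _ eta_gt0 (sqrtr_ge0 _) T2 d0 dq (fun t _ => dd t)).
rewrite pmulr_rgt0// => /(_ W0) H.
have {}H : G <= 4 * (4 * W) / ((T%:R - 1) * eta).
  apply: H => t tT; rewrite GE.
  by have := ttmin t tT; rewrite !gradE ler_sqrt.
have : norm1 g.1 + norm1 g.2 <= 2 * G.
  rewrite -ler_sqr ?nnegrE ?mulr_ge0 ?sqrtr_ge0 ?addr_ge0 ?norm1_ge0//.
  rewrite exprMn GE /q -/(gap _) /lam -/g.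
  have := sqr_ge0 (norm1 g.1 - norm1 g.2); rewrite !expr2; nra.
move=> /le_trans; apply.
(* 32 = 2 * 4 * 4: the sum of the two norms against [G], the factor of [sublinear_rate], and the
   diameter 4 W. *)
have -> : 32 * (2 * M + (ln (1 / s) + 1) / beta) / ((T%:R - 1) * eta)
  = 2 * (4 * (4 * W) / ((T%:R - 1) * eta)) by rewrite /W; ring.
by rewrite ler_pM2l.
Qed.

End Ascent.

(** * Rounding *)

Section Rounding.
Variables (R : realType) (m n : nat).
Implicit Types (F : 'M[R]_(m, n)) (mu : 'cV[R]_m).

Definition row_scale F mu i : R := Num.min 1 (mu i 0 / \sum_j F i j).

Definition row_clip F mu : 'M[R]_(m, n) := \matrix_(i, j) (row_scale F mu i * F i j).

End Rounding.

Section RoundingClip.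
Variables (R : realType) (m n : nat) (F : 'M[R]_(m, n)).
Variables (mu : 'cV[R]_m) (nu : 'cV[R]_n).

(** The column pass is a row pass on the transpose, so one set of lemmas serves both. *)
Definition clip : 'M[R]_(m, n) := (row_clip (row_clip F mu)^T nu)^T.

Definition row_deficit : 'cV[R]_m := mu - clip *m ones R n.
Definition col_deficit : 'cV[R]_n := nu - clip^T *m ones R m.

(* When the deficit vanishes so does its norm, whose inverse is then [0]:
   the case distinction of the algorithm is void. *)
Lemma roundingE i j : rounding F mu nu i j =
  clip i j + row_deficit i 0 * col_deficit j 0 / norm1 row_deficit.
Proof.
rewrite /rounding.
set F1 := diag_mx _ *m F.
have F1E : F1 = row_clip F mu.
  by apply/matrixP => i' j'; rewrite /F1 mul_diag_mx [LHS]mxE [RHS]mxE [X in X * _]mxE mulmx_ones.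
set F2 := F1 *m diag_mx _.
have F2E : F2 = clip.
  apply/matrixP => i' j'; rewrite /F2 mul_mx_diag [LHS]mxE [RHS]mxE [RHS]mxE.
  by rewrite [X in _ * X]mxE mulmx_ones F1E mulrC [X in _ = _ * X]mxE.
rewrite F2E -/row_deficit -/col_deficit.
case: eqP => [e0|_]; first by rewrite e0 [X in _ + X * _ / _]mxE !mul0r addr0.
by rewrite mxE [X in _ + X]mxE [X in _ * X]mxE big_ord1 [(col_deficit)^T _ _]mxE mulrC.
Qed.

End RoundingClip.

Lemma norm1_nonneg (R : realType) k (v : 'cV[R]_k) :
  (forall i, 0 <= v i 0) -> norm1 v = \sum_i v i 0.
Proof. by move=> v0; apply: eq_bigr => i _; rewrite ger0_norm. Qed.

Section RowClip.
Variables (R : realType) (m n : nat) (F : 'M[R]_(m, n)) (mu : 'cV[R]_m).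
Hypotheses (F0 : forall i j, 0 <= F i j) (mu0 : forall i, 0 <= mu i 0).

Lemma row_clip_ge0 i j : 0 <= row_clip F mu i j.
Proof.
by rewrite mxE mulr_ge0// /row_scale le_min ler01 divr_ge0// sumr_ge0.
Qed.

Lemma row_clip_le i j : row_clip F mu i j <= F i j.
Proof. by rewrite mxE -[leRHS]mul1r ler_wpM2r// /row_scale ge_min lexx. Qed.

Lemma sum_row_clip i :
  \sum_j row_clip F mu i j = Num.min (\sum_j F i j) (mu i 0).
Proof.
under eq_bigr do rewrite mxE.
rewrite -mulr_sumr /row_scale; set r := \sum_j F i j.
have r0 : 0 <= r by rewrite sumr_ge0.
have [->|rN] := eqVneq r 0; first by rewrite mulr0 min_l.
by rewrite minr_pMl// mul1r divfK.
Qed.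

End RowClip.

Section RoundingTheory.
Variables (R : realType) (m n : nat) (F : 'M[R]_(m, n)).
Variables (mu : 'cV[R]_m) (nu : 'cV[R]_n).
Hypotheses (F0 : forall i j, 0 <= F i j) (F1 : \sum_i \sum_j F i j = 1).
Hypotheses (muP : prob_vec mu) (nuP : prob_vec nu).

Let mu0 := muP.1.
Let nu0 := nuP.1.

Local Notation G := (row_clip F mu).
Local Notation H := (clip F mu nu).
Local Notation e := (row_deficit F mu nu).
Local Notation e' := (col_deficit F mu nu).

Let Gt0 j i : 0 <= G^T j i.
Proof. by rewrite mxE row_clip_ge0. Qed.

Let clip_ge0 i j : 0 <= H i j.
Proof. by rewrite mxE row_clip_ge0. Qed.

Let clip_le1 i j : H i j <= G i j.
Proof. by rewrite mxE; apply: le_trans (row_clip_le _ Gt0 _ _) _; rewrite mxE. Qed.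

Let sum_clip_col j : \sum_i H i j = Num.min (\sum_i G i j) (nu j 0).
Proof.
under eq_bigr do rewrite mxE.
by rewrite sum_row_clip//; congr (Num.min _ _); apply: eq_bigr => i _; rewrite mxE.
Qed.

Let eE i : e i 0 = mu i 0 - \sum_j H i j.
Proof. by rewrite mxE [X in _ + X]mxE mulmx_ones. Qed.

Let e'E j : e' j 0 = nu j 0 - \sum_i H i j.
Proof. by rewrite mxE [X in _ + X]mxE trmx_mul_ones. Qed.

Let e_ge0 i : 0 <= e i 0.
Proof.
rewrite eE subr_ge0; apply: (@le_trans _ _ (\sum_j G i j)); first exact: ler_sum.
by rewrite sum_row_clip// ge_min lexx orbT.
Qed.

Let e'_ge0 j : 0 <= e' j 0.
Proof. by rewrite e'E subr_ge0 sum_clip_col ge_min lexx orbT. Qed.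

Let sum_e : \sum_i e i 0 = 1 - \sum_i \sum_j H i j.
Proof. by under eq_bigr do rewrite eE; rewrite sumrB muP.2. Qed.

Let sum_e' : \sum_j e' j 0 = \sum_i e i 0.
Proof.
under eq_bigr do rewrite e'E.
by rewrite sumrB nuP.2 exchange_big sum_e.
Qed.

Let fill_ge0 i j : 0 <= e i 0 * e' j 0 / norm1 e.
Proof. by rewrite divr_ge0 ?mulr_ge0 ?norm1_ge0. Qed.

Let sum_fill_row i : \sum_j e i 0 * e' j 0 / norm1 e = e i 0.
Proof.
rewrite -mulr_suml -mulr_sumr sum_e' -norm1_nonneg//.
(* If the total deficit is zero, every entry of the nonnegative deficit is zero, in agreement with 0
   inverting to 0. *)
have [z|nz] := eqVneq (norm1 e) 0; last by rewrite mulfK.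
rewrite z invr0 mulr0; apply/esym/eqP; rewrite eq_le e_ge0 andbT.
by rewrite -z norm1_nonneg// (bigD1 i)//= lerDl sumr_ge0.
Qed.

Let sum_fill_col j : \sum_i e i 0 * e' j 0 / norm1 e = e' j 0.
Proof.
rewrite -mulr_suml -mulr_suml -norm1_nonneg// mulrAC.
have [z|nz] := eqVneq (norm1 e) 0; last by rewrite mulfV// mul1r.
rewrite z mul0r mul0r; apply/esym/eqP; rewrite eq_le e'_ge0 andbT.
by rewrite -z norm1_nonneg// -sum_e' (bigD1 j)//= lerDl sumr_ge0.
Qed.

Lemma rounding_coupling : coupling mu nu (rounding F mu nu).
Proof.
split.
- apply/matrixP => i k; rewrite (ord1 k) mulmx_ones.
  under eq_bigr do rewrite roundingE.
  by rewrite big_split/= sum_fill_row eE addrC subrK.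
- apply/matrixP => j k; rewrite (ord1 k) trmx_mul_ones.
  under eq_bigr do rewrite roundingE.
  by rewrite big_split/= sum_fill_col e'E addrC subrK.
- by move=> i j; rewrite roundingE addr_ge0.
Qed.

Let double_excess (a b : R) : 2 * (a - Num.min a b) = `|a - b| + (a - b).
Proof.
case: (leP a b) => ab; first by rewrite ler0_norm ?subr_le0//; ring.
by rewrite gtr0_norm ?subr_gt0//; ring.
Qed.

(** The rank-one term restores exactly the mass lost by clipping, so the distance is at most twice
    that loss. The row pass loses half of the row gap: two vectors of equal total have an excess
    equal to half of their l1 distance. The column pass loses at most half of the column gap of [F],
    since the row pass has only lowered the column sums. *)
Lemma rounding_dist :
  \sum_i \sum_j `|rounding F mu nu i j - F i j|
  <= norm1 (F *m ones R n - mu) + norm1 (F^T *m ones R m - nu).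
Proof.
have HF i j : H i j <= F i j by apply: le_trans (clip_le1 i j) (row_clip_le mu F0 i j).
apply: (@le_trans _ _ (\sum_i \sum_j ((F i j - H i j) + e i 0 * e' j 0 / norm1 e))).
  apply: ler_sum => i _; apply: ler_sum => j _; rewrite roundingE addrAC.
  apply: le_trans (ler_normD _ _) _.
  by rewrite distrC ger0_norm ?subr_ge0// ger0_norm.
have -> : \sum_i \sum_j ((F i j - H i j) + e i 0 * e' j 0 / norm1 e)
   = 2 * (1 - \sum_i \sum_j H i j).
  under eq_bigr do rewrite big_split/= sum_fill_row sumrB.
  by rewrite big_split/= sumrB F1 sum_e; ring.
have rE i : (F *m ones R n - mu) i 0 = \sum_j F i j - mu i 0.
  by rewrite mxE [X in _ + X]mxE mulmx_ones.
have cE j : (F^T *m ones R m - nu) j 0 = \sum_i F i j - nu j 0.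
  by rewrite mxE [X in _ + X]mxE trmx_mul_ones.
have -> : norm1 (F *m ones R n - mu) = 2 * (1 - \sum_i \sum_j G i j).
  rewrite /norm1; under eq_bigr do rewrite rE.
  have -> : 1 - \sum_i \sum_j G i j = \sum_i (\sum_j F i j - \sum_j G i j).
    by rewrite sumrB F1.
  rewrite mulr_sumr.
  under [RHS]eq_bigr do rewrite sum_row_clip// double_excess.
  by rewrite big_split/= sumrB F1 muP.2 subrr addr0.
have : 2 * (\sum_j \sum_i G i j - \sum_j \sum_i H i j) <= norm1 (F^T *m ones R m - nu).
  have -> : norm1 (F^T *m ones R m - nu) =
      \sum_j 2 * (\sum_i F i j - Num.min (\sum_i F i j) (nu j 0)).
    under [RHS]eq_bigr do rewrite double_excess.
    rewrite big_split/= sumrB exchange_big/= F1 nuP.2 subrr addr0.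
    by apply: eq_bigr => j _; rewrite cE.
  rewrite -sumrB mulr_sumr; apply: ler_sum => j _.
  rewrite ler_pM2l// sum_clip_col.
  have : \sum_i G i j <= \sum_i F i j by apply: ler_sum => i _; exact: row_clip_le.
  move: (\sum_i G i j) (\sum_i F i j) => a b.
  by case: (leP a (nu j 0)); case: (leP b (nu j 0)); lra.
rewrite [X in X - _]exchange_big [X in _ - X]exchange_big/=.
move: (\sum_i \sum_j G i j) (\sum_i \sum_j H i j) (norm1 _) => a b d; lra.
Qed.

End RoundingTheory.

(** * Entropy and the cost of a Gibbs matrix *)

Lemma entropy_le (R : realType) (I : finType) (p : I -> R) :
  (forall i, 0 < p i) -> \sum_i p i = 1 ->
  - \sum_i p i * ln (p i) <= ln #|I|%:R.
Proof.
move=> p0 p1.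
have I0 : 0 < #|I|%:R :> R.
  rewrite ltr0n lt0n; apply/negP => /eqP/card0_eq I0.
  move: p1; rewrite big1 => [/eqP|i _]; first by rewrite eq_sym oner_eq0.
  by have := I0 i.
have -> : ln #|I|%:R = \sum_i p i * ln #|I|%:R by rewrite -mulr_suml p1 mul1r.
rewrite -subr_le0 -sumrN -sumrB.
(* Gibbs' inequality: ln x <= x - 1 at x = 1 / (p i * #|I|), weighted by [p i]; the resulting bound
   sums to zero. *)
apply: (@le_trans _ _ (\sum_i (#|I|%:R^-1 - p i))).
  apply: ler_sum => i _.
  have -> : - (p i * ln (p i)) - p i * ln #|I|%:R = p i * ln ((p i * #|I|%:R)^-1).
    by rewrite lnV ?lnM ?posrE ?mulr_gt0//; ring.
  apply: (@le_trans _ _ (p i * ((p i * #|I|%:R)^-1 - 1))).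
    rewrite ler_pM2l// -{1}[_^-1](subrKC 1).
    by apply: le_ln1Dx; rewrite ltrBrDl subrr invr_gt0 mulr_gt0.
  by rewrite mulrBr mulr1 invfM mulVKf ?gt_eqF.
have N1 : \sum_(i : I) #|I|%:R^-1 = 1 :> R.
  by rewrite sumr_const -[_^-1 *+ _]mulr_natl; exact: (mulfV (lt0r_neq0 I0)).
by rewrite sumrB p1 N1 subrr.
Qed.

Section GibbsCost.
Variables (R : realType) (m n : nat) (beta : R) (c : 'M[R]_(m, n)).
Hypotheses (beta_gt0 : 0 < beta) (m_gt0 : (0 < m)%N) (n_gt0 : (0 < n)%N).

Lemma frobB_le (A B : 'M[R]_(m, n)) (M : R) : (forall i j, `|c i j| <= M) ->
  frob c A - frob c B <= M * \sum_i \sum_j `|A i j - B i j|.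
Proof.
move=> cM; rewrite /frob -sumrB mulr_sumr; apply: ler_sum => i _.
rewrite -sumrB mulr_sumr; apply: ler_sum => j _.
by rewrite -mulrBr (le_trans (ler_norm _))// normrM ler_wpM2r.
Qed.

(** The cost is a sum of a row term, a column term and -1 / beta times the logarithm of the Gibbs
    matrix g. Equal marginals cancel the first two. What remains is the entropy of g plus the sum of
    pi ln g, which is nonpositive because the entries of g are at most 1. *)
Lemma gibbs_cost_le l (pi : 'M[R]_(m, n)) :
  coupling (gibbs beta c l *m ones R n) ((gibbs beta c l)^T *m ones R m) pi ->
  frob c (gibbs beta c l) <= frob c pi + beta^-1 * ln (m * n)%:R.
Proof.
move=> [pr pc pi0].
set g := gibbs beta c l in pr pc *.
have g0 i j : 0 < g i j by exact: gibbs_gt0.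
have g1 : \sum_i \sum_j g i j = 1 by exact: sum_gibbs.
have cE i j : c i j = l.1 i 0 + l.2 j 0 - beta^-1 * ln (partition_fun beta c l)
    - beta^-1 * ln (g i j).
  rewrite /g gibbsE ln_div ?posrE ?expR_gt0 ?partition_fun_gt0// expRK.
  by move: (ln _) => z; field; rewrite gt_eqF.
have costE (A : 'M[R]_(m, n)) : frob c A =
    \sum_i (A *m ones R n) i 0 * (l.1 i 0 - beta^-1 * ln (partition_fun beta c l))
    + \sum_j (A^T *m ones R m) j 0 * l.2 j 0
    - beta^-1 * \sum_i \sum_j A i j * ln (g i j).
  rewrite /frob.
  have -> : \sum_j (A^T *m ones R m) j 0 * l.2 j 0 = \sum_i \sum_j A i j * l.2 j 0.
    rewrite exchange_big; apply: eq_bigr => j _.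
    by rewrite trmx_mul_ones mulr_suml.
  rewrite mulr_sumr -big_split -sumrB; apply: eq_bigr => i _ /=.
  rewrite mulmx_ones mulr_suml mulr_sumr -big_split -sumrB.
  by apply: eq_bigr => j _ /=; rewrite {1}cE; ring.
rewrite !costE pr pc -[leRHS]addrA lerD2l -mulrN -mulrN -mulrDr ler_pM2l ?invr_gt0//.
have Hp : \sum_i \sum_j pi i j * ln (g i j) <= 0.
  apply: sumr_le0 => i _; apply: sumr_le0 => j _.
  rewrite mulr_ge0_le0// -ln1 ler_ln ?posrE// -g1 (bigD1 i)//= (bigD1 j)//=.
  rewrite -addrA lerDl addr_ge0 ?sumr_ge0// => [j' _|i' _]; first exact: ltW.
  by rewrite sumr_ge0// => j' _; exact: ltW.
have := @entropy_le _ _ (fun p : 'I_m * 'I_n => g p.1 p.2) (fun p => g0 p.1 p.2).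
rewrite -(pair_bigA _ (fun i j => g i j)) g1 => /(_ erefl).
rewrite -(pair_bigA _ (fun i j => g i j * ln (g i j))) card_prod !card_ord/=.
move: Hp (\sum_i \sum_j g i j * _) => + x H.
move: (\sum_i \sum_j pi i j * _) => y Hy; lra.
Qed.

End GibbsCost.

Lemma norm1B (R : realType) k (u v : 'cV[R]_k) : norm1 (u - v) = norm1 (v - u).
Proof.
apply: eq_bigr => i _.
by have -> : (u - v) i 0 = - (v - u) i 0; [rewrite !mxE opprB|rewrite normrN].
Qed.

(** * Error bound and number of steps *)

Section Guarantee.
Variables (R : realType) (m n : nat).
Variables (mu : 'cV[R]_m) (nu : 'cV[R]_n) (c : 'M[R]_(m, n)) (M s : R).
Hypothesis inst : ot_instance mu nu c M s.

Let muP : prob_vec mu. Proof. by case: inst => -[]. Qed.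
Let nuP : prob_vec nu. Proof. by case: inst => -[]. Qed.
Let m_gt0 : (0 < m)%N := prob_vec_gt0 muP.
Let n_gt0 : (0 < n)%N := prob_vec_gt0 nuP.
Let M_gt0 : 0 < M. Proof. by case: inst => -[]. Qed.
Let s_gt0 : 0 < s. Proof. by case: inst => -[]. Qed.
Let cM i j : `|c i j| <= M. Proof. by case: inst => _ []. Qed.

(** Entries of at least [s] summing to 1 force m <= 1 / s and n <= 1 / s. *)
Lemma ot_instance_ln : ln (m * n)%:R <= 2 * ln (1 / s).
Proof.
have [_ [mu_ge nu_ge _]] := inst.
have side k (p : 'cV[R]_k) : prob_vec p -> (forall i, s <= p i 0) -> k%:R <= 1 / s.
  move=> [_ p1] ps; rewrite ler_pdivlMr// -[leRHS]p1.
  apply: le_trans (ler_sum _ (fun i _ => ps i)).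
  by rewrite sumr_const card_ord mulr_natl.
have hm := side _ _ muP mu_ge; have hn := side _ _ nuP nu_ge.
have m0 : 0 < m%:R :> R by rewrite ltr0n.
have n0 : 0 < n%:R :> R by rewrite ltr0n.
have s0 : 0 < 1 / s by rewrite divr_gt0.
rewrite natrM lnM ?posrE//.
have : ln m%:R <= ln (1 / s) by rewrite ler_ln ?posrE.
have : ln n%:R <= ln (1 / s) by rewrite ler_ln ?posrE.
by move: (ln m%:R) (ln n%:R) (ln (1 / s)) => x y z; lra.
Qed.

Lemma ot_instance_ln_ge0 : 0 <= ln (1 / s).
Proof.
have : 0 <= 2 * ln (1 / s).
  by apply: le_trans ot_instance_ln; rewrite ln_ge0// ler1n muln_gt0 m_gt0.
by rewrite pmulr_rge0.
Qed.

Lemma ot_output_le (beta eta : R) (T tt : nat) :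
  0 < beta -> 0 < eta -> eta <= 1 / beta -> (2 <= T)%N ->
  best_iterate beta eta c mu nu T tt ->
  frob c (ot_output beta eta c mu nu tt)
  <= ot_value mu nu c
     + 128 * M * (2 * M + (ln (1 / s) + 1) / beta) / ((T%:R - 1) * eta)
     + beta^-1 * ln (m * n)%:R.
Proof.
(* [x] is the price of one rounding and [z] the entropic bias. Two roundings use 2 y; the stated 128
   = 4 * 32 leaves a factor of two. *)
have combine (x y z u v w t : R) :
    u <= v + x -> v <= w + z -> w <= t + x -> x <= y -> 0 <= y -> u - (4 * y + z) <= t.
  by lra.
move=> b0 e0 eb T2 best.
have gap_le := best_iterate_gap inst b0 e0 eb T2 best.
set l := iterate beta eta c mu nu tt in gap_le *.
pose g := gibbs beta c l.
have g0 i j : 0 <= g i j by rewrite ltW// gibbs_gt0.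
have g1 : \sum_i \sum_j g i j = 1 by exact: sum_gibbs.
set G := norm1 _ + norm1 _ in gap_le.
pose r := g *m ones R n; pose k := g^T *m ones R m.
have rP : prob_vec r.
  by split; [move=> i; rewrite mulmx_ones sumr_ge0|rewrite sum_mulmx_ones].
have kP : prob_vec k.
  by split; [move=> i; rewrite trmx_mul_ones sumr_ge0|rewrite sum_trmx_mul_ones].
have out_le : frob c (ot_output beta eta c mu nu tt) <= frob c g + M * G.
  rewrite -lerBlDl; apply: le_trans (frobB_le _ _ cM) _.
  by rewrite ler_pM2l//; exact: rounding_dist.
(* The value is an infimum: it is enough to bound the cost of every coupling from below, the rounded
   Gibbs matrix showing that one exists. *)
rewrite -addrA -lerBlDr; apply: lb_le_inf.
  exists (frob c (rounding g mu nu)); exists (rounding g mu nu) => //.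
  exact: rounding_coupling.
move=> _ [pi [pr pk pi0] <-].
have pi1 : \sum_i \sum_j pi i j = 1 by rewrite -sum_mulmx_ones pr muP.2.
have cost_le := gibbs_cost_le b0 m_gt0 n_gt0 (rounding_coupling pi0 rP kP).
have back_le : frob c (rounding pi r k) <= frob c pi + M * G.
  rewrite -lerBlDl; apply: le_trans (frobB_le _ _ cM) _.
  rewrite ler_pM2l//; apply: le_trans (rounding_dist pi0 pi1 rP kP) _.
  by rewrite pr pk norm1B [X in _ + X]norm1B.
set W := 2 * M + _ in gap_le *.
have W0 : 0 <= W.
  rewrite addr_ge0 ?mulr_ge0 ?invr_ge0 ?(ltW M_gt0) ?(ltW b0)//.
  by rewrite addr_ge0// ot_instance_ln_ge0.
have T1 : 0 < (T%:R - 1) * eta by rewrite mulr_gt0// subr_gt0 ltr1n.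
have -> : 128 * M * W / ((T%:R - 1) * eta) = 4 * (M * (32 * W / ((T%:R - 1) * eta))).
  by ring.
set Y := 32 * W / _ in gap_le *.
have MY : M * G <= M * Y by rewrite ler_pM2l.
have MY0 : 0 <= M * Y.
  by rewrite mulr_ge0 ?(ltW M_gt0)// divr_ge0 ?(ltW T1)// mulr_ge0.
exact: combine out_le cost_le back_le MY MY0.
Qed.

Definition step_budget (eps : R) :=
  (M / eps) ^+ 2 * ln (m * n)%:R + (M / eps) * (1 + ln (1 / s)).

Lemma step_budget_suffices (eps : R) : (2 <= m * n)%N -> 0 < eps ->
  let beta := 2 * eps^-1 * ln (m * n)%:R in
  let eta := 1 / beta in
  exists T : nat, [/\ (2 <= T)%N, T%:R <= Num.max 2 (3072 * step_budget eps)
    & forall tt : nat, best_iterate beta eta c mu nu T tt ->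
        frob c (ot_output beta eta c mu nu tt) <= ot_value mu nu c + eps].
Proof.
move=> mn2 e0 beta eta; have L0 := ot_instance_ln_ge0.
(* Half of eps goes to the entropic bias. With a = M / eps, the other half requires T - 1 >= 256 a
   (4 a ln (m n) + 1 + ln (1 / s)), which [X] dominates. For X > 1 the rounded-up T is at most X + 2
   <= 3 X, whence 3072. *)
set X := 1024 * step_budget eps.
pose T := if X <= 1 then 2%N else (Num.truncn X).+2.
have lam0 : 0 < ln (m * n)%:R :> R by rewrite ln_gt0// ltr1n.
have b0 : 0 < beta by rewrite !mulr_gt0// invr_gt0.
have eta0 : 0 < eta by rewrite divr_gt0.
have T2 : (2 <= T)%N by rewrite /T; case: ifP.
have XT : X <= T%:R - 1.
  rewrite /T; case: ifP => [|_]; first by lra.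
  by rewrite -natr1 addrK ltW// truncnS_gt.
exists T; split=> //.
  rewrite /T le_max; case: ifPn => [_|]; first by rewrite lexx.
  rewrite -ltNge => X1; apply/orP; right.
  have : (Num.truncn X)%:R <= X by rewrite truncn_le// (le_trans _ (ltW X1)).
  have -> : 3072 * step_budget eps = 3 * X by rewrite /X; ring.
  by rewrite -addn2 natrD; lra.
move=> tt best.
apply: le_trans (ot_output_le b0 eta0 (lexx _) T2 best) _.
rewrite -addrA lerD2l.
move: lam0 L0 XT; rewrite /X /step_budget /eta /beta.
set lam := ln (m * n)%:R; set L := ln (1 / s) => lam0 L0 XT.
have T1 : 0 < T%:R - 1 :> R by rewrite subr_gt0 ltr1n.
have -> : 128 * M * (2 * M + (L + 1) / (2 / eps * lam)) /
   ((T%:R - 1) * (1 / (2 / eps * lam))) =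
   eps * (128 * (M / eps) * (4 * (M / eps) * lam + (L + 1))) / (T%:R - 1).
  by field; rewrite !gt_eqF.
have -> : (2 / eps * lam)^-1 * lam = eps / 2 by field; rewrite !gt_eqF.
have a0 : 0 < M / eps by rewrite divr_gt0.
move: (M / eps) a0 XT => a a0 XT.
rewrite -lerBrDr (_ : eps - eps / 2 = eps / 2); last by field.
rewrite ler_pdivrMr// -[leRHS]mulrA ler_pM2l// ler_pdivlMl//.
apply: le_trans XT.
have : 0 <= a * (1 + L) by rewrite mulr_ge0 ?ltW// ltr_wpDr.
nra.
Qed.

Section Regime.
Variables (K eps : R).
Hypotheses (mn2 : (2 <= m * n)%N) (eps_gt0 : 0 < eps).
Hypothesis eps_le : eps <= K * (M * ln (m * n)%:R / (ln (1 / s) + 1)).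

Let a := M / eps.
Let lam : R := ln (m * n)%:R.
Let L := ln (1 / s).
Let L_ge0 : 0 <= L := ot_instance_ln_ge0.
Let lam_gt0 : 0 < lam. Proof. by rewrite ln_gt0// ltr1n. Qed.
Let a_gt0 : 0 < a. Proof. by rewrite divr_gt0. Qed.

Let L_le : L + 1 <= K * (a * lam).
Proof.
have L1 : 0 < L + 1 by rewrite ltr_wpDl.
move: eps_le; rewrite mulrA ler_pdivlMr// -/lam -/L.
have -> : K * (a * lam) = K * (M * lam) / eps by rewrite /a; field; rewrite gt_eqF.
by rewrite ler_pdivlMr// mulrC.
Qed.

Lemma step_budget_le : step_budget eps <= (1 + K) * (a ^+ 2 * lam).
Proof.
rewrite /step_budget -/a -/lam -/L mulrDl mul1r lerD2l.
have -> : K * (a ^+ 2 * lam) = a * (K * (a * lam)) by ring.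
by rewrite ler_pM2l// addrC.
Qed.

(* [4 L <= (L + 1)^2 <= (K a lam)^2] and [lam <= 2 L]. *)
Lemma quadratic_budget_ge : 2 <= K ^+ 2 * (a ^+ 2 * lam).
Proof.
rewrite -(ler_pM2r lam_gt0).
have -> : K ^+ 2 * (a ^+ 2 * lam) * lam = (K * (a * lam)) ^+ 2 by ring.
apply: (@le_trans _ _ ((L + 1) ^+ 2)).
  have := ot_instance_ln; rewrite -/lam -/L => H.
  have : 0 <= (L - 1) ^+ 2 by exact: sqr_ge0.
  by move: H; rewrite !expr2; lra.
by rewrite ler_sqr ?nnegrE// ?addr_ge0// (le_trans _ L_le)// addr_ge0.
Qed.

End Regime.
End Guarantee.

(** * Straight-line programs *)

Section ProgramCalculus.
Variables (R : realType) (X : Type) (input : X -> nat -> R).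
Implicit Types (A B : (X -> R) -> Prop) (f g h : X -> R) (s d k : nat).

(* Some program of length at most [s], the same for all inputs, leaves the value
   of every function in [A] in a register, and touches only finitely many. *)
Definition available s A := exists P k, (size P <= s)%N /\
  forall f, A f -> exists2 i, (i < k)%N & forall x, run P (input x) i = f x.

Definition add_fun A f g := A g \/ g = f.

(** Quantifying over larger sets [B] builds in weakening: an operand stays computable after other
    values have been stored. *)
Definition computable_in A d f := forall s B, (forall g, A g -> B g) ->
  available s B -> available (s + d) (add_fun B f).

Lemma available_le s s' A : (s <= s')%N -> available s A -> available s' A.
Proof.
by move=> ss' [P [k [Ps kP]]]; exists P, k; split=> //; exact: leq_trans ss'.
Qed.

Lemma run_rcons P ins (r : nat -> R) : run (rcons P ins) r = exec (run P r) ins.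
Proof. by rewrite /run -cats1 foldl_cat. Qed.

(* A fresh destination register keeps everything computed so far. *)
Lemma available_instr s A f (P : seq instr) k ins (v : (nat -> R) -> R) :
  (size P <= s)%N ->
  (forall g, A g -> exists2 i, (i < k)%N & forall x, run P (input x) i = g x) ->
  (forall r, exec r ins = set_reg r k (v r)) ->
  (forall x, v (run P (input x)) = f x) ->
  available s.+1 (add_fun A f).
Proof.
move=> Ps AP insE vE; exists (rcons P ins), k.+1; split; first by rewrite size_rcons.
move=> g [/AP[j jk jP]|->].
  exists j; first exact: leqW.
  by move=> x; rewrite run_rcons insE /set_reg ltn_eqF// jP.
by exists k => // x; rewrite run_rcons insE /set_reg eqxx vE.
Qed.

Lemma computable_mem A f : A f -> computable_in A 0 f.
Proof.
move=> Af s B AB [P [k [Ps kP]]]; exists P, k; split; first by rewrite addn0.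
by move=> g [/kP|->] //; exact/kP/AB.
Qed.

Lemma computable_le A d d' f :
  computable_in A d f -> (d <= d')%N -> computable_in A d' f.
Proof.
move=> fA dd' s B AB /(fA _ _ AB); apply: available_le.
by rewrite leq_add2l.
Qed.

Lemma computable_eq A d f g : f =1 g -> computable_in A d f -> computable_in A d g.
Proof. by move=> /funext->. Qed.

Lemma available_sub s A B : (forall g, A g -> B g) -> available s B -> available s A.
Proof. by move=> AB [P [k [Ps kP]]]; exists P, k; split=> // g /AB/kP. Qed.

Lemma computable_lit A c : computable_in A 1 (fun=> c%:R).
Proof.
move=> s B _ [P [k [Ps kP]]]; rewrite addn1.
exact: (available_instr (ins := ILit k c) (v := fun=> c%:R) Ps kP).
Qed.

Lemma computable_unary A d f (op : R -> R) (ins : nat -> nat -> instr) :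
  (forall r a b, exec r (ins a b) = set_reg r a (op (r b))) ->
  computable_in A d f -> computable_in A d.+1 (fun x => op (f x)).
Proof.
move=> insE fA s B AB /(fA _ _ AB) [P [k [Ps kP]]]; rewrite addnS.
apply: (@available_sub _ _ (add_fun (add_fun B f) (fun x => op (f x)))).
  by move=> g [Bg|->]; [left; left|right].
have [i _ fi] := kP f (or_intror erefl).
apply: (available_instr (ins := ins k i) (v := fun r => op (r i)) Ps kP) => // x.
by rewrite fi.
Qed.

Lemma computable_exp A d f :
  computable_in A d f -> computable_in A d.+1 (fun x => expR (f x)).
Proof. exact: (computable_unary (ins := IExp)). Qed.

Lemma computable_pair A d d' f g : computable_in A d f -> computable_in A d' g ->
  forall s B, (forall h, A h -> B h) -> available s B ->
  available (s + (d + d')) (add_fun (add_fun B f) g).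
Proof.
move=> fA gA s B AB /(fA _ _ AB) av; rewrite addnA.
by apply: gA av => h /AB; left.
Qed.

Lemma computable_binary A d d' f g (op : R -> R -> R)
    (ins : nat -> nat -> nat -> instr) :
  (forall r a b c, exec r (ins a b c) = set_reg r a (op (r b) (r c))) ->
  computable_in A d f -> computable_in A d' g ->
  computable_in A (d + d').+1 (fun x => op (f x) (g x)).
Proof.
move=> insE fA gA s B AB /(computable_pair fA gA AB) [P [k [Ps kP]]].
rewrite addnS.
apply: (@available_sub _ _ (add_fun (add_fun (add_fun B f) g)
  (fun x => op (f x) (g x)))).
  by move=> h [Bh|->]; [left; left; left|right].
have [i _ fi] := kP f (or_introl (or_intror erefl)).
have [j _ gj] := kP g (or_intror erefl).
apply: (available_instr (ins := ins k i j) (v := fun r => op (r i) (r j)) Ps kP) => // x.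
by rewrite fi gj.
Qed.

Lemma computable_add A d d' f g : computable_in A d f -> computable_in A d' g ->
  computable_in A (d + d').+1 (fun x => f x + g x).
Proof. exact: (computable_binary (ins := IAdd)). Qed.

Lemma computable_subr A d d' f g : computable_in A d f -> computable_in A d' g ->
  computable_in A (d + d').+1 (fun x => f x - g x).
Proof. exact: (@computable_binary _ _ _ _ _ (fun a b => a - b) ISub). Qed.

Lemma computable_mul A d d' f g : computable_in A d f -> computable_in A d' g ->
  computable_in A (d + d').+1 (fun x => f x * g x).
Proof. exact: (computable_binary (ins := IMul)). Qed.

Lemma computable_div A d d' f g : computable_in A d f -> computable_in A d' g ->
  computable_in A (d + d').+1 (fun x => f x / g x).
Proof. exact: (@computable_binary _ _ _ _ _ (fun a b => a / b) IDiv). Qed.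

Lemma computable_sel A d1 d2 d3 d4 f1 f2 f3 f4 :
  computable_in A d1 f1 -> computable_in A d2 f2 ->
  computable_in A d3 f3 -> computable_in A d4 f4 ->
  computable_in A (d1 + d2 + (d3 + d4)).+1
    (fun x => if f1 x <= f2 x then f3 x else f4 x).
Proof.
move=> A1 A2 A3 A4 s B AB /(computable_pair A1 A2 AB) av.
have {av} := computable_pair A3 A4 (fun h Ah => or_introl (or_introl (AB h Ah))) av.
move=> [P [k [Ps kP]]]; rewrite addnS addnA.
set h := (fun x => if _ then _ else _).
apply: (@available_sub _ _ (add_fun (add_fun (add_fun (add_fun (add_fun B f1) f2) f3) f4) h)).
  by move=> g [Bg|->]; [do 5 left|right].
have [i1 _ E1] := kP f1 (or_introl (or_introl (or_introl (or_intror erefl)))).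
have [i2 _ E2] := kP f2 (or_introl (or_introl (or_intror erefl))).
have [i3 _ E3] := kP f3 (or_introl (or_intror erefl)).
have [i4 _ E4] := kP f4 (or_intror erefl).
apply: (available_instr (ins := ISel k i1 i2 i3 i4)
  (v := fun r => if r i1 <= r i2 then r i3 else r i4) Ps kP) => // x.
by rewrite E1 E2 E3 E4.
Qed.

Lemma available_family (I : finType) s A d (F : I -> X -> R) :
  available s A -> (forall i, computable_in A d (F i)) ->
  exists A', [/\ forall g, A g -> A' g, forall i, A' (F i)
    & available (s + #|I| * d) A'].
Proof.
move=> av FA; rewrite cardE.
suff [A' [AA' FA' av']] : exists A', [/\ forall g, A g -> A' g,
    forall i, i \in enum I -> A' (F i) & available (s + size (enum I) * d) A'].
  by exists A'; split=> // i; apply: FA'; rewrite mem_enum.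
elim: (enum I) => [|i r [A' [AA' FA' av']]]; first by exists A; rewrite addn0.
exists (add_fun A' (F i)); split=> [g /AA'|j|]; first by left.
  by rewrite in_cons => /orP[/eqP->|/FA']; [right|left].
by rewrite /= mulSn addnCA addnC; exact: FA.
Qed.

Lemma available_fun s A d f : available s A -> computable_in A d f ->
  exists A', [/\ forall g, A g -> A' g, A' f & available (s + d) A'].
Proof. by move=> av /(_ s A (fun _ => id) av); exists (add_fun A f); split=> // [g|]; [left|right]. Qed.

Lemma computable_sum n A d (F : 'I_n -> X -> R) :
  (forall i, computable_in A d (F i)) ->
  computable_in A (n * d.+1).+1 (fun x => \sum_i F i x).
Proof.
elim: n F => [|n IH] F FA.
  apply: (computable_eq (f := fun=> 0%:R)) => [x|]; first by rewrite big_ord0.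
  exact: computable_lit.
apply: (computable_eq (f := fun x => \sum_i F (widen_ord (leqnSn n) i) x + F ord_max x)).
  by move=> x; rewrite big_ord_recr.
apply: computable_le (computable_add (IH _ (fun i => FA _)) (FA ord_max)) _.
by rewrite mulSn; lia.
Qed.

(** A register move, written as a selection with equal branches. *)
Definition copy (a b : nat) := ISel a b b b b.

Lemma run_copies N (dst src : nat -> nat) (r : nat -> R) :
  (forall i j, (i < N)%N -> (j < N)%N -> dst i = dst j -> i = j) ->
  (forall i j, (i < N)%N -> (j < N)%N -> dst i <> src j) ->
  forall i, (i < N)%N ->
    run [seq copy (dst p) (src p) | p <- iota 0 N] r (dst i) = r (src i).
Proof.
move=> inj disj.
pose r' k := run [seq copy (dst p) (src p) | p <- iota 0 k] r.
suff H k : (k <= N)%N -> (forall i, (i < k)%N -> r' k (dst i) = r (src i)) /\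
    (forall i, (i < N)%N -> r' k (src i) = r (src i)).
  by move=> i iN; have [+ _] := H N (leqnn _); apply.
elim: k => [//|k IH] kN; have [IH1 IH2] := IH (ltnW kN).
have -> : r' k.+1 = exec (r' k) (copy (dst k) (src k)).
  by rewrite /r' -addn1 iotaD map_cat cats1 add0n run_rcons.
rewrite /= /set_reg.
split=> i ik.
  case: eqP => [dd|dk]; first by rewrite (inj _ _ _ kN dd) ?if_same ?IH2// (leq_trans ik).
  apply: IH1; rewrite ltn_neqAle -ltnS ik andbT.
  by apply/eqP => ik'; rewrite ik' in dk.
by case: eqP => [/esym/(disj _ _ kN ik)//|_]; exact: IH2.
Qed.

Lemma available_output s A N (F : nat -> X -> R) : available s A ->
  (forall p, (p < N)%N -> A (F p)) ->
  exists2 P, (size P <= s + N * 2)%N &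
    forall x p, (p < N)%N -> run P (input x) p = F p x.
Proof.
move=> [P [k [Ps kP]]] AF.
have /choice[src srcP] : forall p, exists i, (p < N)%N ->
    (i < k)%N /\ forall x, run P (input x) i = F p x.
  move=> p; have [pN|] := boolP (p < N)%N; last by exists 0%N.
  by have [i ik iP] := kP _ (AF p pN); exists i.
(* Source registers may lie among the targets 0 to N - 1, so the values first move to a block
   disjoint from both; this accounts for the 2 N extra instructions. *)
pose base p := (k + N + p)%N.
pose Q1 := [seq copy (base p) (src p) | p <- iota 0 N].
pose Q2 := [seq copy (id p) (base p) | p <- iota 0 N].
exists (P ++ Q1 ++ Q2).
  by rewrite !size_cat !size_map !size_iota muln2 -addnn leq_add2r.
move=> x p pN; rewrite /run !foldl_cat -/(run P _) -/(run Q1 _) -/(run Q2 _).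
rewrite -[X in run Q2 _ X]/(id p) run_copies// /base; last first.
  by move=> i j iN jN; lia.
rewrite -/(base p) /Q1 run_copies//; last first.
- by move=> i j iN jN; have [] := srcP j jN; rewrite /base; lia.
- by move=> i j _ _; rewrite /base; lia.
by have [_ ->] := srcP p pN.
Qed.

End ProgramCalculus.

(** Follows the shape of the expression and leaves the operation count to [lia]. Subtraction and
    division are tried before addition and multiplication, because they unfold to these applied to
    an opposite or an inverse. *)
Ltac compute_from_registers :=
  eapply computable_le;
  [ repeat first
    [ match goal with
      | H : forall _, computable_in _ _ _ _ |- _ => eapply H
      end
    | eapply computable_mem; solve [eauto 10 with nocore]
    | eapply computable_lit
    | eapply computable_exp
    | eapply computable_sel
    | eapply computable_subr
    | eapply computable_add
    | eapply computable_div
    | eapply computable_mul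
    | (eapply computable_sum; intro) ]
  | lia ].

(** * Programs for vectors and matrices *)

Section VectorPrograms.
Variables (R : realType) (X : Type) (input : X -> nat -> R).
Implicit Types (A : (X -> R) -> Prop) (s d : nat).

Local Notation available := (available input).
Local Notation computable_in := (computable_in input).

Definition has_vec A k (v : X -> 'cV[R]_k) := forall i, A (fun x => v x i 0).
Definition has_mx A m n (F : X -> 'M[R]_(m, n)) := forall i j, A (fun x => F x i j).

Lemma available_vec s A d k (v : X -> 'cV[R]_k) : available s A ->
  (forall i, computable_in A d (fun x => v x i 0)) ->
  exists A', [/\ forall g, A g -> A' g, has_vec A' v & available (s + k * d) A'].
Proof. by move=> av /(available_family av); rewrite card_ord. Qed.

Lemma available_mx s A d m n (F : X -> 'M[R]_(m, n)) : available s A ->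
  (forall i j, computable_in A d (fun x => F x i j)) ->
  exists A', [/\ forall g, A g -> A' g, has_mx A' F & available (s + m * n * d) A'].
Proof.
move=> av FA.
have := available_family (F := fun p x => F x p.1 p.2) av (fun p => FA p.1 p.2).
rewrite card_prod !card_ord => -[A' [AA' FA' av']].
by exists A'; split=> // i j; exact: (FA' (i, j)).
Qed.

Lemma computable_norm1 A k (v : X -> 'cV[R]_k) : has_vec A v ->
  computable_in A (k * 5).+1 (fun x => norm1 (v x)).
Proof.
move=> Av; apply: (computable_eq (f := fun x => \sum_i
  (if 0%:R <= v x i 0 then v x i 0 else 0%:R - v x i 0))) => [x|].
  by apply: eq_bigr => i _; case: lerP => h; [rewrite ger0_norm|rewrite ltr0_norm ?sub0r].
by compute_from_registers.
Qed.

Lemma computable_sg A (g : X -> R) : A g ->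
  computable_in A 9 (fun x => Num.sg (g x)).
Proof.
move=> Ag; apply: (computable_eq (f := fun x => if g x <= 0%:R
  then (if 0%:R <= g x then 0%:R else 0%:R - 1%:R) else 1%:R)) => [x|].
  by case: sgrP => h; rewrite ?lexx ?sub0r//; case: ltgtP h.
by compute_from_registers.
Qed.

Lemma computable_row_marginal A m n (F : X -> 'M[R]_(m, n)) : has_mx A F ->
  forall i, computable_in A n.+1 (fun x => (F x *m ones R n) i 0).
Proof.
move=> AF i; apply: (computable_eq (f := fun x => \sum_j F x i j)) => [x|].
  by rewrite mulmx_ones.
by compute_from_registers.
Qed.

Lemma has_mx_tr A m n (F : X -> 'M[R]_(m, n)) : has_mx A F -> has_mx A (fun x => (F x)^T).
Proof.
move=> AF i j; rewrite (_ : (fun x => _) = fun x => F x j i); first exact: AF.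
by apply/funext => x; rewrite mxE.
Qed.

Lemma has_vec_sub A A' k (v : X -> 'cV[R]_k) :
  (forall g, A g -> A' g) -> has_vec A v -> has_vec A' v.
Proof. by move=> AA' Av i; exact/AA'/Av. Qed.

Lemma has_mx_sub A A' m n (F : X -> 'M[R]_(m, n)) :
  (forall g, A g -> A' g) -> has_mx A F -> has_mx A' F.
Proof. by move=> AA' AF i j; exact/AA'/AF. Qed.

Lemma available_marginal_gap s A m n (F : X -> 'M[R]_(m, n)) (mu : X -> 'cV[R]_m) :
  available s A -> has_mx A F -> has_vec A mu ->
  exists A', [/\ forall g, A g -> A' g, has_vec A' (fun x => F x *m ones R n - mu x)
    & available (s + m * n.+2) A'].
Proof.
move=> av AF Amu; apply: (available_vec av) => i.
apply: (computable_eq (f := fun x => (F x *m ones R n) i 0 - mu x i 0)) => [x|].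
  by rewrite [RHS]mxE [X in _ = _ + X]mxE.
have cm := computable_row_marginal AF.
by compute_from_registers.
Qed.

Lemma available_dual_step s A k (eta : X -> R) (v g : X -> 'cV[R]_k) :
  available s A -> A eta -> A (fun x => norm1 (g x)) -> has_vec A v -> has_vec A g ->
  exists A', [/\ forall g, A g -> A' g,
    has_vec A' (fun x => mean_shift (v x - sign_step (eta x) (g x)))
    & available (s + (k * 17 + 5)) A'].
Proof.
move=> av Aeta Ag1 Av Ag; pose w x := v x - sign_step (eta x) (g x).
have [|A1 [S1 Aw av1]] := available_vec (v := w) (d := 14) av.
  move=> i; apply: (computable_eq (f := fun x => v x i 0
    - eta x / 2%:R * norm1 (g x) * Num.sg (g x i 0))) => [x|].
    by rewrite /w [RHS]mxE [X in _ = _ + X]mxE sign_stepE.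
  have csg j : computable_in A 9 (fun x => Num.sg (g x j 0)) := computable_sg (Ag j).
  by compute_from_registers.
(* The mean is stored once; recomputing it for every entry would cost k^2 operations. *)
have [|A2 [S2 Am av2]] := available_fun (d := k + 5) (f := fun x =>
    k%:R^-1 * \sum_i w x i 0) av1.
  apply: (computable_eq (f := fun x => 1%:R / k%:R * \sum_i w x i 0)) => [x|].
    by rewrite div1r.
  by compute_from_registers.
have [|A3 [S3 A3w av3]] := available_vec (v := fun x => mean_shift (w x)) (d := 1) av2.
  move=> i; apply: (computable_eq (f := fun x => w x i 0 -
    k%:R^-1 * \sum_i w x i 0)) => [x|]; first by rewrite mean_shiftE.
  by compute_from_registers.
exists A3; split=> //; first by eauto.
by apply: available_le av3; lia.
Qed.

Lemma available_gibbs s A m n (beta : X -> R) (c : X -> 'M[R]_(m, n))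
    (l : X -> 'cV[R]_m * 'cV[R]_n) :
  available s A -> A beta -> has_mx A c ->
  has_vec A (fun x => (l x).1) -> has_vec A (fun x => (l x).2) ->
  exists A', [/\ forall g, A g -> A' g,
    has_mx A' (fun x => gibbs (beta x) (c x) (l x))
    & available (s + (m * n * 8 + m * 2 + 1)) A'].
Proof.
move=> av Ab Ac A1 A2.
pose w x : 'M[R]_(m, n) := \matrix_(i, j) gibbs_weight (beta x) (c x) (l x) i j.
have [|B1 [S1 Bw av1]] := available_mx (F := w) (d := 6) av.
  move=> i j; apply: (computable_eq (f := fun x => expR ((0%:R - beta x) *
    (c x i j - (l x).1 i 0 - (l x).2 j 0)))) => [x|]; first by rewrite mxE sub0r.
  by compute_from_registers.
have [|B2 [S2 Bz av2]] := available_fun (d := m * (n + 2) + 1) (f := fun x =>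
    \sum_i \sum_j w x i j) av1.
  by compute_from_registers.
have [|B3 [S3 Bg av3]] := available_mx (F := fun x => gibbs (beta x) (c x) (l x))
    (d := 1) av2.
  move=> i j; apply: (computable_eq (f := fun x => w x i j / \sum_i \sum_j w x i j)).
    move=> x; rewrite !mxE; congr (_ / _); apply: eq_bigr => i' _.
    by apply: eq_bigr => j' _; rewrite mxE.
  by compute_from_registers.
exists B3; split=> //; first by eauto.
by apply: available_le av3; lia.
Qed.

Lemma available_row_clip s A m n (F : X -> 'M[R]_(m, n)) (mu : X -> 'cV[R]_m) :
  available s A -> has_mx A F -> has_vec A mu ->
  exists A', [/\ forall g, A g -> A' g, has_mx A' (fun x => row_clip (F x) (mu x))
    & available (s + (m * n * 3 + m * 7)) A'].
Proof.
move=> av AF Amu.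
have [|B1 [S1 Bx av1]] := available_vec (v := fun x => \col_i row_scale (F x) (mu x) i)
    (d := 2 * n + 7) av.
  move=> i; apply: (computable_eq (f := fun x =>
    if 1%:R <= mu x i 0 / \sum_j F x i j then 1%:R else mu x i 0 / \sum_j F x i j)).
    by move=> x; rewrite mxE /row_scale; case: leP.
  by compute_from_registers.
have [|B2 [S2 BG av2]] := available_mx (F := fun x => row_clip (F x) (mu x)) (d := 1) av1.
  move=> i j; apply: (computable_eq (f := fun x =>
    (\col_i row_scale (F x) (mu x) i) i 0 * F x i j)) => [x|]; first by rewrite !mxE.
  by compute_from_registers.
exists B2; split=> //; first by eauto.
by apply: available_le av2; lia.
Qed.

Lemma available_rounding s A m n (F : X -> 'M[R]_(m, n))
    (mu : X -> 'cV[R]_m) (nu : X -> 'cV[R]_n) :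
  available s A -> has_mx A F -> has_vec A mu -> has_vec A nu ->
  exists A', [/\ forall g, A g -> A' g, has_mx A' (fun x => rounding (F x) (mu x) (nu x))
    & available (s + (m * n * 12 + m * 14 + n * 9 + 1)) A'].
Proof.
move=> av AF Amu Anu.
have [B1 [S1 B1G av1]] := available_row_clip av AF Amu.
have [B2 [S2 /has_mx_tr B2H av2]] := available_row_clip av1 (has_mx_tr B1G)
  (has_vec_sub S1 Anu).
have {}B2H : has_mx B2 (fun x => clip (F x) (mu x) (nu x)) by exact: B2H.
have S12 g : A g -> B2 g by eauto.
have [|B3 [S3 B3e av3]] := available_vec (v := fun x => row_deficit (F x) (mu x) (nu x))
    (d := n + 2) av2.
  move=> i; apply: (computable_eq (f := fun x => mu x i 0
    - (clip (F x) (mu x) (nu x) *m ones R n) i 0)) => [x|].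
    by rewrite [RHS]mxE [X in _ = _ + X]mxE.
  have cm := computable_row_marginal B2H.
  by compute_from_registers.
have [|B4 [S4 B4e av4]] := available_vec (v := fun x => col_deficit (F x) (mu x) (nu x))
    (d := m + 2) av3.
  move=> j; apply: (computable_eq (f := fun x => nu x j 0
    - ((clip (F x) (mu x) (nu x))^T *m ones R m) j 0)) => [x|].
    by rewrite [RHS]mxE [X in _ = _ + X]mxE.
  have cm := computable_row_marginal (has_mx_tr (has_mx_sub S3 B2H)).
  by compute_from_registers.
have B4r := has_vec_sub S4 B3e.
have [B5 [S5 B5n av5]] := available_fun av4 (computable_norm1 B4r).
have [|B6 [S6 B6r av6]] := available_mx (F := fun x => rounding (F x) (mu x) (nu x))
    (d := 3) av5.
  move=> i j; apply: (computable_eq (f := fun x => clip (F x) (mu x) (nu x) i j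
   + row_deficit (F x) (mu x) (nu x) i 0 * col_deficit (F x) (mu x) (nu x) j 0
     / norm1 (row_deficit (F x) (mu x) (nu x)))) => [x|].
    by rewrite roundingE.
  by compute_from_registers.
exists B6; split; [|exact: B6r|]; first by eauto 10.
by apply: available_le av6; lia.
Qed.

End VectorPrograms.

(** * The ascent as a program *)

Record ot_problem (R : realType) m n := OtProblem {
  p_beta : R; p_eta : R; p_c : 'M[R]_(m, n); p_mu : 'cV[R]_m; p_nu : 'cV[R]_n }.

Section AscentProgram.
Variables (R : realType) (m n : nat).
Hypotheses (m_gt0 : (0 < m)%N) (n_gt0 : (0 < n)%N).
Local Notation X := (ot_problem R m n).
Implicit Types (x : X) (A : (X -> R) -> Prop) (s t k : nat).

Definition problem_regs x :=
  input_regs (p_beta x) (p_eta x) (p_c x) (p_mu x) (p_nu x).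

Local Notation available := (available problem_regs).

Definition dual_iterate t x :=
  iterate (p_beta x) (p_eta x) (p_c x) (p_mu x) (p_nu x) t.

Definition iterate_gibbs t x := gibbs (p_beta x) (p_c x) (dual_iterate t x).

(** Twice the squared dual norm of the gradient: it has the same minimizers and avoids the square
    root, which is not an instruction. *)
Definition square_gap t x : R :=
  let g := marginal_gap (p_beta x) (p_c x) (p_mu x) (p_nu x) (dual_iterate t x) in
  norm1 g.1 * norm1 g.1 + norm1 g.2 * norm1 g.2.

Definition has_inputs A := [/\ A (@p_beta R m n), A (@p_eta R m n),
  has_mx A (@p_c R m n), has_vec A (@p_mu R m n) & has_vec A (@p_nu R m n)].

Definition has_iterate A t :=
  has_vec A (fun x => (dual_iterate t x).1) /\ has_vec A (fun x => (dual_iterate t x).2).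

Lemma has_inputs_sub A A' : (forall g, A g -> A' g) -> has_inputs A -> has_inputs A'.
Proof.
move=> S [Ab Ae Ac Am An].
by split; [exact: S|exact: S|exact: (has_mx_sub S)|exact: (has_vec_sub S)..].
Qed.

Lemma has_iterate_sub A A' t :
  (forall g, A g -> A' g) -> has_iterate A t -> has_iterate A' t.
Proof. by move=> S [A1 A2]; split; apply: (has_vec_sub S). Qed.

Lemma available_inputs : exists2 A, has_inputs A & available 0 A.
Proof.
pose L x := [:: p_beta x; p_eta x] ++ [seq p_mu x i 0 | i <- enum 'I_m]
  ++ [seq p_nu x j 0 | j <- enum 'I_n]
  ++ [seq p_c x i j | i <- enum 'I_m, j <- enum 'I_n].
pose K := (2 + (m + (n + m * n)))%N.
exists (fun f => exists2 i, (i < K)%N & forall x, nth 0 (L x) i = f x); last first.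
  by exists [::], K.
have sz1 (v : 'cV[R]_m) : size [seq v i 0 | i <- enum 'I_m] = m.
  by rewrite size_map size_enum_ord.
have sz2 (v : 'cV[R]_n) : size [seq v i 0 | i <- enum 'I_n] = n.
  by rewrite size_map size_enum_ord.
have nthv k (v : 'cV[R]_k) (i : 'I_k) : nth 0 [seq v i 0 | i <- enum 'I_k] i = v i 0.
  by rewrite (nth_map i) ?size_enum_ord// nth_ord_enum.
split.
- by exists 0%N.
- by exists 1%N.
- move=> i j; pose s := [seq (i, j) | i <- enum 'I_m, j <- enum 'I_n].
  have ijs : (i, j) \in s by apply: allpairs_f; rewrite mem_enum.
  exists (2 + (m + (n + index (i, j) s)))%N.
    rewrite !ltn_add2l; have := ijs; rewrite -index_mem.
    by rewrite size_allpairs !size_enum_ord.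
  move=> x; rewrite /L nth_cat /= subSS subSS subn0 nth_cat sz1 ltnNge leq_addr/= addKn.
  rewrite nth_cat sz2 ltnNge leq_addr/= addKn.
  have -> : [seq p_c x i j | i <- enum 'I_m, j <- enum 'I_n] =
    [seq p_c x p.1 p.2 | p <- s] by rewrite map_allpairs.
  by rewrite (nth_map (i, j)) ?index_mem// nth_index.
- move=> i; exists (2 + i)%N; first by rewrite ltn_add2l ltn_addr.
  by move=> x; rewrite /L nth_cat /= subSS subSS subn0 nth_cat sz1 ltn_ord.
- move=> j; exists (2 + (m + j))%N; first by rewrite !ltn_add2l ltn_addr.
  move=> x; rewrite /L nth_cat /= subSS subSS subn0 nth_cat sz1 ltnNge leq_addr/= addKn.
  by rewrite nth_cat sz2 ltn_ord.
Qed.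

Lemma available_iterate0 A s : available s A ->
  exists A', [/\ forall g, A g -> A' g, has_iterate A' 0 & available (s + 1) A'].
Proof.
move=> av0; have [A' [S A0 av]] := available_fun av0 (computable_lit 0).
exists A'; split=> //; split=> i.
  by rewrite (_ : (fun x => _) = fun=> 0%:R)//; apply/funext => x; rewrite mxE.
by rewrite (_ : (fun x => _) = fun=> 0%:R)//; apply/funext => x; rewrite mxE.
Qed.

Lemma available_ascent_step A s t : available s A -> has_inputs A -> has_iterate A t ->
  exists A', [/\ forall g, A g -> A' g, has_iterate A' t.+1,
    has_mx A' (iterate_gibbs t), A' (square_gap t)
    & available (s + m * n * 80) A'].
Proof.
move=> av [Ab Ae Ac Am An] [A1 A2].
have [B1 [S1 Bg av1]] := available_gibbs av Ab Ac A1 A2.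
have [B2 [S2 B2g av2]] := available_marginal_gap av1 Bg (has_vec_sub S1 Am).
have [B3 [S3 B3g av3]] := available_marginal_gap av2
  (has_mx_tr (has_mx_sub S2 Bg)) (has_vec_sub S2 (has_vec_sub S1 An)).
have {}B2g := has_vec_sub S3 B2g.
have [B4 [S4 B4n av4]] := available_fun av3 (computable_norm1 B2g).
have [B5 [S5 B5n av5]] := available_fun av4 (computable_norm1 (has_vec_sub S4 B3g)).
have S15 g : A g -> B5 g by eauto 10.
have S35 g : B3 g -> B5 g by eauto.
have [B6 [S6 B6p av6]] := available_dual_step av5 (S15 _ Ae) (S5 _ B4n)
  (has_vec_sub S15 A1) (has_vec_sub S35 B2g).
have S36 g : B3 g -> B6 g by eauto.
have S16 g : A g -> B6 g by eauto.
have [B7 [S7 B7p av7]] := available_dual_step av6 (S16 _ Ae) (S6 _ B5n)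
  (has_vec_sub S16 A2) (has_vec_sub S36 B3g).
have [|B8 [S8 B8q av8]] := available_fun (f := square_gap t) (d := 3) av7.
  have N1 := S7 _ (S6 _ (S5 _ B4n)); have N2 := S7 _ (S6 _ B5n).
  apply: computable_le (computable_add (computable_mul (computable_mem N1)
    (computable_mem N1)) (computable_mul (computable_mem N2) (computable_mem N2))) _.
  by [].
exists B8; split.
- by eauto 10.
- split; [exact: has_vec_sub S8 (has_vec_sub S7 B6p)|exact: has_vec_sub S8 B7p].
- by apply: (has_mx_sub _ Bg); eauto 10.
- exact: B8q.
- apply: available_le av8; move: m_gt0 n_gt0; clear; nia.
Qed.

(** An argmin over steps 1 to [k.+1], iterate 0 being excluded. The index depends on the data and is
    never stored; only its gap and its Gibbs matrix are, updated by the same comparison as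
    [ISel]. *)
Fixpoint best_index k x : nat :=
  if k isn't k'.+1 then 1%N else
  if square_gap (best_index k' x) x <= square_gap k'.+2 x then best_index k' x else k'.+2.

Lemma best_indexP k x : (1 <= best_index k x <= k.+1)%N /\
  forall t, (1 <= t <= k.+1)%N -> square_gap (best_index k x) x <= square_gap t x.
Proof.
elim: k => [|k [IHr IH]].
  by split=> [|t]; [|rewrite -eqn_leq => /eqP<-; exact: lexx].
rewrite /=; case: (leP (square_gap (best_index k x) x)) => le.
  split; first by case/andP: IHr => -> /= /leqW.
  move=> t /andP[t1]; rewrite leq_eqVlt => /orP[/eqP->|tk]; first exact: le.
  by apply: IH; rewrite t1.
split; first by rewrite leqnn.
move=> t /andP[t1]; rewrite leq_eqVlt => /orP[/eqP->|tk]; first exact: lexx.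
by apply: (le_trans (ltW le)); apply: IH; rewrite t1.
Qed.

Definition has_best A k :=
  A (fun x => square_gap (best_index k x) x) /\
  has_mx A (fun x => iterate_gibbs (best_index k x) x).

(** The pass that evaluates the gap of iterate [k.+1] also produces iterate [k.+2]. Each later pass
    adds to the 80 m n operations one selection for the gap and m n for the matrix, within 82 m
    n. *)
Lemma available_best k : exists A, [/\ has_inputs A, has_iterate A k.+2, has_best A k
  & available (1 + k.+2 * (m * n * 82)) A].
Proof.
elim: k => [|k [A [Ain Ait [Aq AF] av]]].
  have [A Ain av] := available_inputs.
  have [A0 [S0 A0it av0]] := available_iterate0 av.
  have A0in := has_inputs_sub S0 Ain.
  have [A1 [S1 A1it _ _ av1]] := available_ascent_step av0 A0in A0it.
  have A1in := has_inputs_sub S1 A0in.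
  have [A2 [S2 A2it A2F A2q av2]] := available_ascent_step av1 A1in A1it.
  exists A2; split=> //; first exact: has_inputs_sub A1in.
  by apply: available_le av2; lia.
have [B [S Bit BF Bq avB]] := available_ascent_step av Ain Ait.
have SAq := S _ Aq; have SAF := has_mx_sub S AF.
have [|C [SC Cq avC]] := available_fun (d := 1)
    (f := fun x => square_gap (best_index k.+1 x) x) avB.
  apply: (computable_eq (f := fun x =>
      if square_gap (best_index k x) x <= square_gap k.+2 x
      then square_gap (best_index k x) x else square_gap k.+2 x)).
    by move=> x /=; case: ifP.
  exact: computable_sel (computable_mem SAq) (computable_mem Bq)
    (computable_mem SAq) (computable_mem Bq).
have [|D [SD DF avD]] := available_mx (d := 1)
    (F := fun x => iterate_gibbs (best_index k.+1 x) x) avC.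
  move=> i j; apply: (computable_eq (f := fun x =>
      if square_gap (best_index k x) x <= square_gap k.+2 x
      then iterate_gibbs (best_index k x) x i j else iterate_gibbs k.+2 x i j)).
    by move=> x /=; case: ifP.
  exact: computable_sel (computable_mem (SC _ SAq)) (computable_mem (SC _ Bq))
    (computable_mem (SC _ (SAF i j))) (computable_mem (SC _ (BF i j))).
exists D; split.
- by apply: has_inputs_sub Ain; eauto.
- by apply: has_iterate_sub Bit; eauto.
- by split; [exact: SD|exact: DF].
- apply: available_le avD; move: m_gt0 n_gt0; clear; nia.
Qed.

Lemma best_index_iterate k (x : X) : 0 < p_beta x ->
  best_iterate (p_beta x) (p_eta x) (p_c x) (p_mu x) (p_nu x) k.+1 (best_index k x).
Proof.
move=> b0; have [r opt] := best_indexP k x; split; first exact: r.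
move=> t /opt le.
have gradE t' : iterate_grad_norm (p_beta x) (p_eta x) (p_c x) (p_mu x) (p_nu x) t'
    = Num.sqrt (2^-1 * square_gap t' x).
  rewrite /iterate_grad_norm gradient_dual_obj; [|exact: b0|exact: m_gt0|exact: n_gt0].
  by rewrite /dual_norm !expr2.
by rewrite !gradE; apply: ler_wsqrtr; rewrite ler_pM2l ?invr_gt0.
Qed.

End AscentProgram.

Lemma computes_ot_output_succ (R : realType) m n k :
  exists2 P, computes_ot_output R m.+1 n.+1 k.+1 P
    & (size P <= 250 * (m.+1 * n.+1 * k.+1))%N.
Proof.
have [A [[_ _ _ Am An] _ [_ AF] av]] :=
  available_best R (ltn0Sn m) (ltn0Sn n) k.
have [B [_ BF {}av]] := available_rounding av AF Am An.
(* Decodes the row-major position [p]; successor dimensions make [inord] available. *)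
pose F p (x : ot_problem R m.+1 n.+1) := rounding (iterate_gibbs (best_index k x) x)
  (p_mu x) (p_nu x) (inord (p %/ n.+1)) (inord (p %% n.+1)).
have [P Ps PF] := available_output (F := F) (N := m.+1 * n.+1) av (fun p _ => BF _ _).
exists P; last first.
  by apply: leq_trans Ps _; clear; nia.
move=> beta eta c mu nu b0 _ _ _.
pose x := OtProblem beta eta c mu nu.
exists (best_index k x); first exact: (@best_index_iterate R m.+1 n.+1 isT isT k x b0).
move=> i j; have := PF x (i * n.+1 + j)%N; rewrite /F /= => ->.
  by rewrite divnMDl// modnMDl divn_small// modn_small// addn0 !inord_val.
have := ltn_ord i; have := ltn_ord j; clear; nia.
Qed.

Lemma computes_ot_output_linear (R : realType) : exists2 a, (0 < a)%N &
  forall m n T, (0 < m)%N -> (0 < n)%N -> (0 < T)%N ->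
  exists2 P, computes_ot_output R m n T P & (size P <= a * (m * n * T))%N.
Proof.
exists 250%N => // m n T m0 n0 T0.
case: m => [|m] in m0 *; first by rewrite ltnn in m0.
case: n => [|n] in n0 *; first by rewrite ltnn in n0.
case: T => [|T] in T0 *; first by rewrite ltnn in T0.
exact: computes_ot_output_succ.
Qed.

Lemma in_regime_complexity (R : realType) (C K : R) : 0 < C -> 0 < K ->
  exists C' : R, 0 < C' /\
    forall (m n : nat) (mu : 'cV[R]_m) (nu : 'cV[R]_n) (c : 'M[R]_(m, n))
      (M s eps : R),
    ot_instance mu nu c M s -> (2 <= m * n)%N -> 0 < eps ->
    eps <= K * (M * ln (m * n)%:R / (ln (1 / s) + 1)) ->
    forall T : nat, (2 <= T)%N ->
      T%:R <= Num.max 2 (C * step_budget m n M s eps) ->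
      T%:R <= Num.max 2 (C' * ((M / eps) ^+ 2 * ln (m * n)%:R)) /\
      exists P : seq instr, computes_ot_output R m n T P /\
        (size P)%:R <= C' * ((M / eps) ^+ 2 * (m * n)%:R * ln (m * n)%:R).
Proof.
have [a a0 program] := computes_ot_output_linear R.
(* The program size bound has no maximum with 2. The regime absorbs it: 2 <= K^2 Y for the quadratic
   budget Y, while the full budget is at most (1 + K) Y, so T <= D Y in both cases. *)
move=> C0 K0; pose D : R := C * (1 + K) + K ^+ 2.
have D0 : 0 < D by rewrite addr_gt0 ?exprn_gt0// mulr_gt0// addr_gt0.
exists (a%:R * D); split; first by rewrite mulr_gt0// ltr0n.
move=> m n mu nu c M s eps inst mn2 e0 epsK T T2 TC.
have m0 : (0 < m)%N by case: inst => -[/prob_vec_gt0].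
have n0 : (0 < n)%N by case: inst => -[_ /prob_vec_gt0].
have QY := step_budget_le inst e0 epsK.
have Y2 := quadratic_budget_ge inst mn2 e0 epsK.
rewrite -[(M / eps) ^+ 2 * (m * n)%:R * _]mulrAC.
move: (step_budget m n M s eps) ((M / eps) ^+ 2 * ln (m * n)%:R) TC Y2 QY => Q Y TC Y2 QY.
have Y0 : 0 < Y by rewrite -(pmulr_rgt0 _ (exprn_gt0 2 K0)) (lt_le_trans _ Y2).
have TD : T%:R <= D * Y.
  apply: le_trans TC _; rewrite ge_max /D mulrDl -[C * _ * _]mulrA.
  have CQ : C * Q <= C * ((1 + K) * Y) by rewrite ler_pM2l.
  apply/andP; split; last by rewrite ler_wpDr// mulr_ge0 ?sqr_ge0 ?(ltW Y0).
  by rewrite ler_wpDl// mulr_ge0 ?(ltW C0)// mulr_ge0 ?addr_ge0 ?(ltW K0) ?(ltW Y0).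
split.
  rewrite le_max -mulrA; apply/orP; right; apply: le_trans TD _.
  by rewrite -[leLHS]mul1r ler_wpM2r ?ler1n// mulr_ge0 ?(ltW D0) ?(ltW Y0).
have [P Pok Ps] := program m n T m0 n0 (ltnW T2).
exists P; split; first exact: Pok.
apply: (@le_trans _ _ (a * (m * n * T))%N%:R); first by rewrite ler_nat.
rewrite natrM -mulrA ler_pM2l ?ltr0n// natrM mulrA [leRHS]mulrC.
by rewrite ler_wpM2l.
Qed.

Theorem theorem25 (R : realType) :
  (forall (m n : nat) (mu : 'cV[R]_m) (nu : 'cV[R]_n) (c : 'M[R]_(m, n))
      (M s beta eta : R) (T tt : nat),
    ot_instance mu nu c M s ->
    0 < beta -> 0 < eta -> eta <= 1 / beta -> (2 <= T)%N ->
    best_iterate beta eta c mu nu T tt ->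
    frob c (ot_output beta eta c mu nu tt)
    <= ot_value mu nu c
       + 128 * M * (2 * M + (ln (1 / s) + 1) / beta) / ((T%:R - 1) * eta)
       + beta^-1 * ln (m * n)%:R)
  /\
  (exists C : R, 0 < C /\
    (forall (m n : nat) (mu : 'cV[R]_m) (nu : 'cV[R]_n) (c : 'M[R]_(m, n))
        (M s eps : R),
      ot_instance mu nu c M s -> (2 <= m * n)%N -> 0 < eps ->
      let beta := 2 * eps^-1 * ln (m * n)%:R in
      let eta := 1 / beta in
      exists T : nat,
        [/\ (2 <= T)%N,
            T%:R <= Num.max 2 (C * ((M / eps) ^+ 2 * ln (m * n)%:R
                                    + (M / eps) * (1 + ln (1 / s))))
          & forall tt : nat, best_iterate beta eta c mu nu T tt ->
              frob c (ot_output beta eta c mu nu tt)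
              <= ot_value mu nu c + eps])
    /\
    (forall K : R, 0 < K -> exists C' : R, 0 < C' /\
      forall (m n : nat) (mu : 'cV[R]_m) (nu : 'cV[R]_n) (c : 'M[R]_(m, n))
        (M s eps : R),
      ot_instance mu nu c M s -> (2 <= m * n)%N -> 0 < eps ->
      eps <= K * (M * ln (m * n)%:R / (ln (1 / s) + 1)) ->
      forall T : nat, (2 <= T)%N ->
        T%:R <= Num.max 2 (C * ((M / eps) ^+ 2 * ln (m * n)%:R
                                + (M / eps) * (1 + ln (1 / s)))) ->
        T%:R <= Num.max 2 (C' * ((M / eps) ^+ 2 * ln (m * n)%:R))
        /\
        exists P : seq instr,
          computes_ot_output R m n T P /\
          (size P)%:R
          <= C' * ((M / eps) ^+ 2 * (m * n)%:R * ln (m * n)%:R))).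
Proof.
split.
  move=> m n mu nu c M s beta eta T tt inst b0 e0 eb T2 best.
  exact: (ot_output_le inst b0 e0 eb T2 best).
exists 3072; split; first by rewrite ltr0n.
split.
  move=> m n mu nu c M s eps inst mn2 e0.
  exact: (step_budget_suffices inst mn2 e0).
by move=> K K0; apply: in_regime_complexity; first by rewrite ltr0n.
Qed.
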